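(* Let $K\subset\mathbb C$ be compact and convex. Let $P_n(z,w)=\sum_{j=0}^dp_{j,n}(z)w^j$ ($n\ge1$) and $P(z,w)=\sum_{j=0}^dp_j(z)w^j$ be polynomials with the same $w$-degree $d$, and assume $p_{j,n}\to p_j$ uniformly on a neighborhood of $K$ for each $j$. Let $f_n,f$ be positive algebraic germs satisfying $P_n(z,f_n(z))=0$ and $P(z,f(z))=0$, and assume that $\mathcal M_{f_n}(K)$ and $\mathcal M_f(K)$ are nonempty. Suppose $m_k(f_n)\to m_k(f)$ as $n\to\infty$ for every $k\ge0$. Then $$\liminf_{n\to\infty}\delta_{P_n}(f_n;K)\ge\delta_P(f;K).$$ If a minimizer $\mu$ for $\delta_P(f;K)$ admits a recovery sequence $\mu_n\in\mathcal M_{f_n}(K)$ with $\mu_n\to\mu$ weak-$*$, then $$\delta_{P_n}(f_n;K)\longrightarrow\delta_P(f;K).$$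
   Context: For a finite compactly supported measure $\mu$ on $\mathbb C$, its Cauchy transform is $\mathcal C_\mu(z)=\int_{\mathbb C}\frac{d\mu(\zeta)}{z-\zeta}$ (defined almost everywhere, in $L^1_{\mathrm{loc}}$). A positive algebraic germ is an algebraic analytic germ at infinity $f(z)=a_0/z+O(z^{-2})$, $a_0>0$; its Laurent coefficients $m_k(f)$ are defined by $f(z)=\sum_{k\ge0}m_k(f)z^{-k-1}$ near infinity. $\mathcal M_f(K)$ is the set of positive measures $\mu$ supported in $K$ whose Cauchy transform has germ $f$ at infinity (equivalently $\int\zeta^k\,d\mu=m_k(f)$ for all $k\ge0$). With $d=\deg_wP\ge1$ and $dA$ planar Lebesgue measure, $\mathfrak D_{P,K}(\mu)=\int_K|P(z,\mathcal C_\mu(z))|^{1/d}\,dA(z)$, and $\delta_P(f;K)=\min_{\mu\in\mathcal M_f(K)}\mathfrak D_{P,K}(\mu)$ (attained); a minimizer is a $\mu\in\mathcal M_f(K)$ attaining it. Weak-$*$ convergence is that of $C(K)^*$. *)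

(* Defs.v *)
From HB Require Import structures.
From mathcomp Require Import all_boot all_order all_algebra.
From mathcomp Require Import all_classical all_reals all_analysis.
From mathcomp Require Import complex.

Set Implicit Arguments.
Unset Strict Implicit.
Unset Printing Implicit Defensive.

Import Order.TTheory GRing.Theory Num.Theory.
Import numFieldNormedType.Exports.

Local Open Scope classical_set_scope.
Local Open Scope ring_scope.
Local Open Scope complex_scope.

(* Sets, measures and topology of the complex plane live on R * R (product
   topology, product Borel sigma-algebra); complex arithmetic takes place in
   R[i], and [toC] is the identification between the two. *)
Definition toC (R : realType) (z : R * R) : R[i] := z.1 +i* z.2.

(* [measurableTypeR R] is R with its Borel sigma-algebra. *)
Definition area (R : realType) :
    {measure set (measurableTypeR R * measurableTypeR R)%type -> \bar R} :=
  (lebesgue_measure \x lebesgue_measure)%E.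

Notation finite_measureC R :=
  {finite_measure set (measurableTypeR R * measurableTypeR R)%type -> \bar R}.

Definition near_infty (R : realType) (p : R[i] -> Prop) : Prop :=
  exists r : R, forall z : R[i], r%:C < `|z| -> p z.

Definition integralC (R : realType) (mu : finite_measureC R)
    (h : R * R -> R[i]) : R[i] :=
  (\int[mu]_z complex.Re (h z)) +i* (\int[mu]_z complex.Im (h z)).

(* Total version of the Cauchy transform: the value is meaningful wherever the
   integral converges absolutely, that is, almost everywhere for the area. *)
Definition cauchy_transform (R : realType) (mu : finite_measureC R)
    (z : R[i]) : R[i] :=
  integralC mu (fun zeta => (z - toC zeta)^-1).

(* An analytic germ at infinity that vanishes there, with its Laurent
   coefficients: f(z) = \sum_(k >= 0) m_k z^(-k-1) near infinity. *)
Record germ (R : realType) := Germ {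
  germ_fun :> R[i] -> R[i] ;
  germ_coef : nat -> R[i] ;
  germ_laurent : near_infty (fun z : R[i] =>
    (series (fun k => germ_coef k * z ^- k.+1) : nat -> R[i]^o) @ \oo
      --> (germ_fun z : R[i]^o)) }.

(* Bivariate polynomials are elements of {poly {poly R[i]}} whose outer variable
   is w: the polynomial P`_j in z is the coefficient of w ^ j. *)
Definition eval2 (R : realType) (P : {poly {poly R[i]}}) (z w : R[i]) : R[i] :=
  P.[w%:P].[z].

Definition degw (R : realType) (P : {poly {poly R[i]}}) : nat := (size P).-1.

Definition annihilates (R : realType) (P : {poly {poly R[i]}}) (f : germ R) :
    Prop :=
  near_infty (fun z => eval2 P z (f z) = 0).

(* [0 < a] in R[i] means that a is real and positive. *)
Definition positive_algebraic (R : realType) (f : germ R) : Prop :=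
  (exists2 Q : {poly {poly R[i]}}, Q != 0 & annihilates Q f) /\
  0 < germ_coef f 0.

Definition representing (R : realType) (f : germ R) (K : set (R * R)) :
    set (finite_measureC R) :=
  [set mu : finite_measureC R | mu (~` K) = 0%E /\
            near_infty (fun z => cauchy_transform mu z = f z)].

Definition defect (R : realType) (P : {poly {poly R[i]}}) (K : set (R * R))
    (mu : finite_measureC R) : \bar R :=
  (\int[area R]_(z in K)
    ((Normc.normc (eval2 P (toC z) (cauchy_transform mu (toC z))))
       `^ ((degw P)%:R^-1))%:E)%E.

(* The minimum of the defect, written as an infimum in \bar R; the two agree
   because the minimum is attained as soon as [representing f K] is nonempty. *)
Definition delta (R : realType) (P : {poly {poly R[i]}}) (f : germ R)
    (K : set (R * R)) : \bar R :=
  ereal_inf [set defect P K mu | mu in representing f K].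

Definition minimizer (R : realType) (P : {poly {poly R[i]}}) (f : germ R)
    (K : set (R * R)) (mu : finite_measureC R) : Prop :=
  representing f K mu /\ defect P K mu = delta P f K.

(* Weak-* convergence in C(K)^*. *)
Definition weak_star_cvg (R : realType) (K : set (R * R))
    (mu_ : nat -> finite_measureC R) (mu : finite_measureC R) : Prop :=
  forall g : R * R -> R, {within K, continuous g} ->
    (\int[mu_ n]_(z in K) g z)%R @[n --> \oo] --> (\int[mu]_(z in K) g z)%R.

(* Main.v *)
(* Choose nearly optimal measures for P_n along a subsequence realising the
   liminf.  Their masses m_0(f_n) are bounded, so a further subsequence converges
   weak-* to some mu carried by K.  Expanding the Cauchy transform at infinity,
   membership in M_f(K) amounts to prescribing the moments, hence mu is in M_f(K).
   The kernel 1/z is locally integrable for the area and continuous away from 0;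
   splitting off a small neighbourhood of the pole (Tonelli) and using dominated
   convergence on the rest, the Cauchy transforms converge in L^1(K).  Finally
     | |P_n(z,w')|^(1/d) - |P(z,w)|^(1/d) | <= theta (1 + 2|w|) + Q |w - w'|
   on K for n large, with theta as small as desired, so that L^1 convergence of
   the Cauchy transforms gives convergence of the defects.  A recovery sequence
   bounds the limsup in the same way. *)

Require Import Defs.
From HB Require Import structures.
From mathcomp Require Import all_boot all_order all_algebra.
From mathcomp Require Import all_classical all_reals all_analysis.
From mathcomp Require Import measurable_realfun complex ring lra zify.
Import Order.TTheory GRing.Theory Num.Theory.
Import numFieldNormedType.Exports.
Local Open Scope classical_set_scope.
Local Open Scope ring_scope.

Set Implicit Arguments.
Unset Strict Implicit.
Unset Printing Implicit Defensive.

(** The obstacle in the compactness step is that limits of cell masses need not be the masses of the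
    cells for any measure: mass can slide onto the boundary of a cell and there belong to its
    neighbour. What survives the limit is additivity on the binary tree of cells. The tree is
    therefore copied onto an interval cut into half-open pieces of the prescribed lengths, where
    Lebesgue measure is at hand, and sample points of the shrinking cells push it forward to a
    measure on K. Individual cells may lose their limit masses, but integrals of continuous
    functions do not notice. The exponent 1/d is what makes L^1 convergence sufficient. The pole 1/z
    is not locally square integrable, so for d >= 2 the function |P(z, C)| itself may have infinite
    integral, whereas its d-th root grows only linearly in C. Accordingly the errors in P are
    arranged as d-th powers before roots are taken. The pole is majorised by a series of indicators
    of squares, so that Tonelli requires no integral beyond the area of a square. *)

Local Notation plane R := (measurableTypeR R * measurableTypeR R)%type.

(** * Borel sets and measurable functions of the plane; area of squares *)

(** The sigma-algebra is the product one, so an open set is exhibited as the countable union of the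
    rectangles with rational endpoints that it contains. *)
Lemma plane_open_measurable (R : realType) (A : set (R * R)) :
  open A -> measurable (A : set (plane R)).
Proof.
move=> oA.
pose rect (q : (rat * rat) * (rat * rat)) : set (plane R) :=
  `]ratr q.1.1, ratr q.1.2[%classic `*` `]ratr q.2.1, ratr q.2.2[%classic.
have -> : A = \bigcup_q (if `[< rect q `<=` A >] then rect q else set0).
  apply/seteqP; split => [z Az|z [q _]]; last by case: asboolP => // qA /qA.
  have /nbhs_ballP[e /= e0 eA] : nbhs z A by apply: open_nbhs_nbhs.
  have box (x : R) : exists q : rat * rat, [/\ ratr q.1 < x, x < ratr q.2 &
      forall y : R, ratr q.1 < y -> y < ratr q.2 -> `|x - y| < e].
    have [a] : exists a, ratr a \in `]x - e, x[.
      by apply: rat_in_itvoo; rewrite ltrBlDr ltrDl.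
    have [b] : exists b, ratr b \in `]x, x + e[.
      by apply: rat_in_itvoo; rewrite ltrDl.
    rewrite !in_itv/= => /andP[xb be] /andP[ea ax].
    exists (a, b); split => //= y ay yb.
    by rewrite ltr_norml; apply/andP; split; lra.
  have [[a b] /= [az zb abz]] := box z.1.
  have [[c d] /= [cz zd cdz]] := box z.2.
  exists ((a, b), (c, d)) => //; case: asboolP => [_|[]].
    by split; rewrite /= in_itv/= ?az ?zb ?cz ?zd.
  move=> w [/=]; rewrite !in_itv/= => /andP[aw wb] /andP[cw wd].
  by apply: eA; split; [exact: abz|exact: cdz].
apply: countable_bigcupT_measurable => [|q]; first exact: countableP.
by case: asboolP => // _; apply: measurableX; exact: measurable_itv.
Qed.

Lemma plane_closed_measurable (R : realType) (A : set (R * R)) :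
  closed A -> measurable (A : set (plane R)).
Proof.
by move=> /closed_openC/plane_open_measurable/measurableC; rewrite setCK.
Qed.

Lemma plane_compact_measurable (R : realType) (K : set (R * R)) :
  compact K -> measurable (K : set (plane R)).
Proof.
by move=> /compact_closed cK; apply: plane_closed_measurable; apply: cK;
  exact: norm_hausdorff.
Qed.

Lemma plane_continuous_measurable (R : realType) (g : R * R -> R) :
  continuous g -> measurable_fun setT (g : plane R -> R).
Proof.
move=> cg; apply: (measurability _ (measurable_realfun.RGenOpens.measurableE R)).
move=> _ [_ [a [b ->] <-]]; rewrite setTI.
by apply: plane_open_measurable; move/continuousP : cg; apply; exact: interval_open.
Qed.

Lemma squareE (R : realType) (x y e : R) :
  [set z : plane R | `|z.1 - x| < e /\ `|z.2 - y| < e] =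
  `]x - e, x + e[%classic `*` `]y - e, y + e[%classic.
Proof.
apply/seteqP; split => z /=; rewrite !in_itv/= !ltr_norml.
  by move=> [/andP[? ?] /andP[? ?]]; split; apply/andP; split; lra.
by move=> [/andP[? ?] /andP[? ?]]; split; apply/andP; split; lra.
Qed.

Lemma measurable_square (R : realType) (x y e : R) :
  measurable [set z : plane R | `|z.1 - x| < e /\ `|z.2 - y| < e].
Proof. by rewrite squareE; apply: measurableX; exact: measurable_itv. Qed.

Lemma area_square (R : realType) (x y e : R) : 0 <= e ->
  area R [set z | `|z.1 - x| < e /\ `|z.2 - y| < e] = ((2 * e) ^+ 2)%:E.
Proof.
move=> e0; rewrite squareE /area/= product_measure1E; last 2 first.
  exact: measurable_itv.
  exact: measurable_itv.
have L c : lebesgue_measure (`]c - e, c + e[%classic : set R) = (2 * e)%:E.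
  rewrite lebesgue_measure_itv/= lte_fin.
  have [e0'|e0'] := ltP 0 e; last by rewrite ifF; [congr (_%:E)|apply/negbTE]; lra.
  by rewrite ifT; [rewrite -EFinB; congr (_%:E)|]; lra.
transitivity ((2 * e)%:E * (2 * e)%:E)%E; last by rewrite -EFinM expr2.
by congr (_ * _)%E; exact: L.
Qed.

Lemma area_sigma_finite (R : realType) : sigma_finite setT (area R).
Proof.
exists (fun n => [set z | `|z.1 - 0| < n%:R :> R /\ `|z.2 - 0| < n%:R :> R]).
  apply/seteqP; split => // z _.
  exists (Num.truncn (`|z.1| + `|z.2|)).+1 => //=; rewrite !subr0.
  have := truncnS_gt (`|z.1| + `|z.2|); have := normr_ge0 z.1; have := normr_ge0 z.2.
  by split; lra.
by move=> n; split; [exact: measurable_square|rewrite area_square// ltry].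
Qed.


Lemma measurable_fun_inv d (T : measurableType d) (R : realType) (f : T -> R) :
  measurable_fun setT f -> measurable_fun setT (fun x => (f x)^-1).
Proof.
(* The inverse is a sign times a real power of [|f|], which reduces the claim to the measurability
   of [powR]; where f vanishes both sides are 0. *)
move=> mf; have -> : (fun x => (f x)^-1) =
    (fun x => (\1_[set r : R | 0 <= r] (f x) - \1_[set r : R | r < 0] (f x)) * `|f x| `^ (-1)).
  apply/funext => x; rewrite powR_inv1// !indicE.
  have [f0|f0] := leP 0 (f x).
    by rewrite mem_set// memNset ?subr0 ?mul1r ?ger0_norm//= ltNge f0.
  by rewrite memNset ?mem_set//= ?leNgt ?f0// ltr0_norm// sub0r mulN1r invrN opprK.
apply: measurable_funM.
  apply: measurable_funB; apply: (measurableT_comp _ mf); apply: measurable_indic.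
    rewrite (_ : [set r | _] = `[0, +oo[%classic); first exact: measurable_itv.
    by apply/seteqP; split => r /=; rewrite in_itv/= andbT.
  rewrite (_ : [set r | _] = `]-oo, 0[%classic); first exact: measurable_itv.
  by apply/seteqP; split => r /=; rewrite in_itv.
apply: (measurableT_comp (measurable_powR _)); exact: measurableT_comp.
Qed.

(** * Convolution with kernels having an integrable pole *)

(** Both parts of the Cauchy transform have this form, with kernels [u.1 / sqnorm u] and
    [- u.2 / sqnorm u]. The value is 0 where the integral is not finite. *)
Definition conv (R : realType) (mu : finite_measureC R) (k : R * R -> R)
    (z : R * R) : R :=
  \int[mu]_w k (z.1 - w.1, z.2 - w.2).

Lemma measurable_diff (R : realType) :
  measurable_fun setT
    (fun p : plane R * plane R => (p.1.1 - p.2.1, p.1.2 - p.2.2) : plane R).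
Proof.
have m11 : measurable_fun setT (fun p : plane R * plane R => p.1.1 : R).
  by apply: (@measurableT_comp _ _ _ _ _ _ fst) => //; exact: measurable_fst.
have m12 : measurable_fun setT (fun p : plane R * plane R => p.1.2 : R).
  by apply: (@measurableT_comp _ _ _ _ _ _ snd) => //; exact: measurable_snd.
have m21 : measurable_fun setT (fun p : plane R * plane R => p.2.1 : R).
  by apply: (@measurableT_comp _ _ _ _ _ _ fst) => //; exact: measurable_fst.
have m22 : measurable_fun setT (fun p : plane R * plane R => p.2.2 : R).
  by apply: (@measurableT_comp _ _ _ _ _ _ snd) => //; exact: measurable_snd.
by apply: measurable_fun_pair; apply: measurable_funB.
Qed.

Lemma measurable_diffr (R : realType) (z : R * R) :
  measurable_fun setT (fun w : plane R => (z.1 - w.1, z.2 - w.2) : plane R).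
Proof.
by apply: measurable_fun_pair; apply: measurable_funB.
Qed.

Lemma measurable_diffl (R : realType) (w : R * R) :
  measurable_fun setT (fun z : plane R => (z.1 - w.1, z.2 - w.2) : plane R).
Proof.
by apply: measurable_fun_pair; apply: measurable_funB.
Qed.

Lemma measurable_conv (R : realType) (mu : finite_measureC R) (k : R * R -> R) :
  measurable_fun setT (k : plane R -> R) ->
  measurable_fun setT (conv mu k : plane R -> R).
Proof.
move=> mk; apply: (measurableT_comp (@fine_measurable R setT measurableT)) => //.
pose f (p : plane R * plane R) := (k (p.1.1 - p.2.1, p.1.2 - p.2.2))%:E.
have mf : measurable_fun setT f.
  apply/measurable_EFinP.
  exact: (measurableT_comp mk (@measurable_diff R)).
(* Measurability in the parameter comes from Tonelli, which concerns nonnegative integrands, hence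
   the split into positive and negative parts. *)
have -> : (fun z : plane R => \int[mu]_w (k (z.1 - w.1, z.2 - w.2)%R)%:E)%E =
   (fun z => fubini_F mu (f^\+)%E z - fubini_F mu (f^\-)%E z)%E.
  apply/funext => z; rewrite integralE /fubini_F; congr (_ - _)%E; apply: eq_integral => w _.
  - by rewrite !funeposE.
  - by rewrite !funenegE.
apply: emeasurable_funB; apply: measurable_fun_fubini_tonelli_F => //.
- exact: measurable_funepos.
- exact: measurable_funeneg.
Qed.

Definition dyadic_square (R : realType) (n : nat) : set (plane R) :=
  [set v | `|v.1| < 2 ^- n /\ `|v.2| < 2 ^- n].

(* The dyadic majorant of 1/|u| near the origin: each term is constant on a
   square, so that its area integrals reduce to a geometric series. *)
Definition dyadic_pole (R : realType) (m : nat) (u : R * R) : \bar R :=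
  (\sum_(0 <= i <oo) ((2 ^ (i + m.+1))%:R *
     \1_(@dyadic_square R (i + m)) u)%:E)%E.

Lemma dyadic_pole_ge0 (R : realType) m (u : R * R) : (0 <= dyadic_pole m u)%E.
Proof. by apply: nneseries_ge0 => i _ _; rewrite lee_fin mulr_ge0. Qed.

Lemma measurable_dyadic_term (R : realType) m i : measurable_fun setT
  (fun u : plane R => ((2 ^ (i + m.+1))%:R * (
     \1_(@dyadic_square R (i + m)) u : R))%:E).
Proof.
apply/measurable_EFinP; apply: measurable_funM => //.
apply: measurable_indic.
have := @measurable_square R 0 0 (2 ^- (i + m)).
by congr measurable; apply/seteqP; split => z; rewrite /dyadic_square/= !subr0.
Qed.

Lemma measurable_dyadic_pole (R : realType) m :
  measurable_fun setT (@dyadic_pole R m : plane R -> \bar R).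
Proof.
apply: ge0_emeasurable_sum => [i u _ _|i _]; first by rewrite lee_fin mulr_ge0.
exact: measurable_dyadic_term.
Qed.

Lemma half_pow_lt (R : realType) (e : R) : 0 < e -> exists n, 2 ^- n < e.
Proof.
move=> e0; exists (Num.truncn e^-1).+1.
rewrite invf_plt ?posrE ?exprn_gt0// (lt_le_trans (truncnS_gt _))//.
by rewrite -natrX ler_nat ltnW// ltn_expl.
Qed.

(** Let n be the last level whose square contains u. Then x is at least 2^-(n+1+m), so that the n-th
    term of the series alone, 2^(n+m+1), already exceeds 1/x. *)
Lemma dyadic_pole_ge (R : realType) m (u : R * R) (x : R) :
  u != (0, 0) -> `|u.1| < 2 ^- m -> `|u.2| < 2 ^- m ->
  `|u.1| <= x -> `|u.2| <= x ->
  (x^-1%:E <= dyadic_pole m u)%E.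
Proof.
move=> u0 u1 u2 xu1 xu2.
have small (r : R) : (forall n, `|r| < 2 ^- (n + m)) -> r = 0.
  move=> rn; apply: contrapT => /eqP; rewrite -normr_gt0 => r0.
  have [n rn'] := half_pow_lt r0.
  have := lt_trans rn' (rn n); rewrite ltNge => /negP; apply.
  by rewrite lef_pV2 ?posrE ?exprn_gt0// ler_weXn2l ?ler1n ?leq_addr.
have [n [un1 un2 nun]] : exists n, [/\ `|u.1| < 2 ^- (n + m),
    `|u.2| < 2 ^- (n + m) & ~ (`|u.1| < 2 ^- (n.+1 + m) /\ `|u.2| < 2 ^- (n.+1 + m))].
  apply: contrapT => nex.
  have all n : `|u.1| < 2 ^- (n + m) /\ `|u.2| < 2 ^- (n + m).
    elim: n => [|n [un1 un2]]; first by rewrite add0n.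
    by apply: contrapT => nun; apply: nex; exists n.
  have := small u.2 (fun n => (all n).2); have := small u.1 (fun n => (all n).1).
  by move/eqP : u0; case: u {u1 u2 xu1 xu2 all nex} => a b /= u0 a0 b0; apply: u0; rewrite a0 b0.
have x0 : 2 ^- (n.+1 + m) <= x.
  by move/not_andP : nun => [/negP|/negP]; rewrite -leNgt => h; apply: (le_trans h).
apply: (@le_trans _ _ ((2 ^ (n + m.+1))%:R * \1_(@dyadic_square R (n + m)) u)%:E).
  rewrite lee_fin indicE mem_set// mulr1 natrX addnS -addSn.
  by rewrite invf_ple ?posrE ?exprn_gt0// (lt_le_trans _ x0)// invr_gt0 exprn_gt0.
apply: le_trans (nneseries_lim_ge n.+1 _); last by move=> k _ _; rewrite lee_fin mulr_ge0.
rewrite big_nat_recr//= leeDr//.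
by apply: sume_ge0 => k _; rewrite lee_fin mulr_ge0.
Qed.

(** By Tonelli the area integral is computed first, and by translation it does not depend on w. The
    i-th term gives 2^(i+m+1) times the area 4 / 4^(i+m), that is 16 / 2^(i+m+1); the geometric
    series sums to 16 / 2^m. *)
Lemma integral_dyadic_pole (R : realType) (mu : finite_measureC R) m :
  (\int[area R]_z \int[mu]_w dyadic_pole m (z.1 - w.1, z.2 - w.2)%R =
   (16 / 2 ^+ m)%:E * mu setT)%E.
Proof.
pose f (p : plane R * plane R) := dyadic_pole m (p.1.1 - p.2.1, p.1.2 - p.2.2).
have mf : measurable_fun setT f.
  exact: (measurableT_comp (@measurable_dyadic_pole R m) (@measurable_diff R)).
(* The area is packed together with its sigma-finiteness, which Tonelli requires. *)
have := @fubini_tonelli _ _ _ _ _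
  (HB.pack_for {sigma_finite_measure set (plane R) -> \bar R} (Measure.sort (area R))
    (Measure_isSigmaFinite.Build _ _ _ (area R) (@area_sigma_finite R))) mu f mf
    (fun p => dyadic_pole_ge0 _ _).
rewrite /f/= => ->.
rewrite -integral_cst//; apply: eq_integral => w _ /=.
rewrite /dyadic_pole integral_nneseries//; last first.
  by move=> i; exact: (measurableT_comp (@measurable_dyadic_term R m i) (@measurable_diffl R w)).
have <- : (\sum_(0 <= k <oo) (16 / (2 ^ (k + m.+1))%:R)%:E)%E = (16 / 2 ^+ m)%:E :> \bar R.
  by apply/cvg_lim => //; exact: cvg_geometric_eseries_half.
apply: eq_eseriesr => i _.
pose B := [set v : plane R | `|v.1 - w.1| < 2 ^- (i + m) /\ `|v.2 - w.2| < 2 ^- (i + m)].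
transitivity (\int[area R]_z ((2 ^ (i + m.+1))%:R%:E * (\1_B z)%:E))%E.
  by apply: eq_integral => z _; rewrite -EFinM; congr (_ * _)%:E;
    rewrite !indicE /B /dyadic_square/= !inE.
rewrite ge0_integralZl//; last first.
  by apply/measurable_EFinP/measurable_indic; exact: measurable_square.
rewrite integral_indic ?setIT//; last exact: measurable_square.
rewrite area_square; last by rewrite invr_ge0 exprn_ge0.
rewrite -EFinM; congr (_%:E).
rewrite addnS natrX exprS; set c : R := 2 ^+ (i + m).
have c0 : c != 0 by rewrite expf_neq0.
by field.
Qed.

Lemma integral_support (R : realType) (mu : finite_measureC R) (K : set (R * R))
    (f : plane R -> \bar R) :
  measurable (K : set (plane R)) -> mu (~` K) = 0%E -> measurable_fun setT f ->
  (\int[mu]_(z in K) f z = \int[mu]_z f z)%E.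
Proof.
move=> mK muK mf; rewrite integral_mkcond.
apply: ae_eq_integral => //.
  by apply/(measurable_restrictT _ mK); exact: measurable_funTS.
exists (~` K); split => //; first exact: measurableC.
by move=> z /= zK; apply: contra_not zK => Kz _; rewrite patchE mem_set.
Qed.

Lemma Rintegral_support (R : realType) (mu : finite_measureC R) (K : set (R * R))
    (g : R * R -> R) :
  measurable (K : set (plane R)) -> mu (~` K) = 0%E ->
  measurable_fun setT (g : plane R -> R) ->
  \int[mu]_(z in K) g z = \int[mu]_z g z.
Proof.
by move=> mK muK mg; congr fine; apply: integral_support => //; exact/measurable_EFinP.
Qed.

Lemma bounded_integrable (R : realType) (mu : finite_measureC R)
    (g : R * R -> R) (B : R) :
  measurable_fun setT (g : plane R -> R) -> (forall u, `|g u| <= B) ->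
  mu.-integrable setT (EFin \o (g : plane R -> R)).
Proof.
move=> mg gB; apply: measurable_bounded_integrable => //.
  by rewrite ltey_eq fin_num_measure.
exists B; split; first exact: num_real.
by move=> x Bx z _; exact: le_trans (gB z) (ltW Bx).
Qed.

(** The bound is trivial at a point z where the right-hand side is infinite. Elsewhere k - k' is
    integrable by domination, hence so is k because k' is bounded, and linearity of the integral
    applies. *)
Lemma conv_approx (R : realType) (mu : finite_measureC R) (k k' : R * R -> R)
    (m : nat) (B : R) :
  measurable_fun setT (k : plane R -> R) -> measurable_fun setT (k' : plane R -> R) ->
  (forall u, `|k' u| <= B) ->
  (forall u, (`|k u - k' u|%:E <= dyadic_pole m u)%E) ->
  forall z : R * R, (`|conv mu k z - conv mu k' z|%:E <=
    \int[mu]_w dyadic_pole m (z.1 - w.1, z.2 - w.2)%R)%E.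
Proof.
move=> mk mk' k'B kk' z.
have mkz : measurable_fun setT (fun w : plane R => k (z.1 - w.1, z.2 - w.2)).
  exact: (measurableT_comp mk (@measurable_diffr R z)).
have mkz' : measurable_fun setT (fun w : plane R => k' (z.1 - w.1, z.2 - w.2)).
  exact: (measurableT_comp mk' (@measurable_diffr R z)).
have mrho : measurable_fun setT (fun w : plane R => dyadic_pole m (z.1 - w.1, z.2 - w.2)%R).
  exact: (measurableT_comp (@measurable_dyadic_pole R m) (@measurable_diffr R z)).
have [rhoy|rhoNy] := eqVneq (\int[mu]_w dyadic_pole m (z.1 - w.1, z.2 - w.2)%R)%E +oo%E.
  by rewrite rhoy leey.
have irho : mu.-integrable setT (fun w : plane R => dyadic_pole m (z.1 - w.1, z.2 - w.2)%R).
  apply/integrableP; split => //.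
  under eq_integral do rewrite gee0_abs ?dyadic_pole_ge0//.
  by rewrite ltey.
have ik' : mu.-integrable setT (EFin \o (fun w : plane R => k' (z.1 - w.1, z.2 - w.2))).
  by apply: (@bounded_integrable _ _ _ B).
have ikk' : mu.-integrable setT
    (EFin \o (fun w : plane R => k (z.1 - w.1, z.2 - w.2) - k' (z.1 - w.1, z.2 - w.2))).
  apply: le_integrable irho => //.
    by apply/measurable_EFinP; exact: measurable_funB.
  by move=> w _ /=; rewrite (le_trans (kk' _))// gee0_abs// dyadic_pole_ge0.
have ik : mu.-integrable setT (EFin \o (fun w : plane R => k (z.1 - w.1, z.2 - w.2))).
  have := integrableD measurableT ikk' ik'.
  by apply: eq_integrable => // w _ /=; rewrite -EFinD subrK.
rewrite /conv -RintegralB// EFin_normr_Rintegral//.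
apply: (le_trans (le_abse_integral _ _ _)) => //.
  by case/integrableP : ikk'.
apply: ge0_le_integral => //.
  by apply: measurableT_comp => //; case/integrableP : ikk'.
by move=> w _ /=; exact: kk'.
Qed.

Lemma compact_box (R : realType) (K : set (R * R)) : compact K ->
  exists2 r : R, 0 < r & forall z, K z -> `|z.1| < r /\ `|z.2| < r.
Proof.
move=> /compact_bounded[b [_ Kb]]; exists (`|b| + 2) => [|z Kz].
  by rewrite ltr_wpDl.
have b1 : b < `|b| + 1 by rewrite (le_lt_trans (ler_norm _))// ltrDl.
have := Kb _ b1 z Kz; rewrite /= prod_normE/= ge_max.
by move=> /andP[? ?]; split; lra.
Qed.

Lemma compact_area_lty (R : realType) (K : set (R * R)) : compact K ->
  (area R K < +oo)%E.
Proof.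
move=> cK; have [r r0 Kr] := compact_box cK.
pose S := [set z : plane R | `|z.1 - 0| < r /\ `|z.2 - 0| < r].
have : (area R K <= area R S)%E.
  apply: le_measure; rewrite ?inE; [exact: plane_compact_measurable|exact: measurable_square|].
  by move=> z Kz; rewrite /S/= !subr0; exact: Kr.
by move=> /le_lt_trans; apply; rewrite area_square ?ltry// ltW.
Qed.

(** The test functions are continuous on the whole plane, so this follows from [weak_star_cvg].
    Translates of truncated kernels and the parts of monomials are such functions. *)
Definition plane_weak_cvg (R : realType) (K : set (R * R))
    (mu_ : nat -> finite_measureC R) (mu : finite_measureC R) : Prop :=
  forall g : R * R -> R, continuous g ->
    \int[mu_ n]_(z in K) g z @[n --> \oo] --> \int[mu]_(z in K) g z.

Lemma conv_bounded (R : realType) (mu : finite_measureC R) (k : R * R -> R) (B M : R) :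
  measurable_fun setT (k : plane R -> R) -> (forall u, `|k u| <= B) ->
  (mu setT <= M%:E)%E -> forall z, `|conv mu k z| <= B * M.
Proof.
move=> mk kB muM z; rewrite -lee_fin /conv.
have mkz : measurable_fun setT (fun w : plane R => k (z.1 - w.1, z.2 - w.2)).
  exact: (measurableT_comp mk (@measurable_diffr R z)).
have ik : mu.-integrable setT (EFin \o (fun w : plane R => k (z.1 - w.1, z.2 - w.2))).
  by apply: (@bounded_integrable _ _ _ B).
rewrite EFin_normr_Rintegral//.
apply: (le_trans (le_abse_integral _ _ _)) => //; first by case/integrableP : ik.
have B0 : 0 <= B by apply: le_trans (kB (0, 0)).
apply: (@le_trans _ _ (\int[mu]_w (cst B%:E) w)%E).
  apply: ge0_le_integral => //.
    by apply: measurableT_comp => //; case/integrableP : ik.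
  by move=> w _ /=; rewrite lee_fin.
by rewrite integral_cst// EFinM lee_wpmul2l// lee_fin.
Qed.

Lemma continuous_diffr (R : realType) (k : R * R -> R) (z : R * R) :
  continuous k -> continuous (fun w : R * R => k (z.1 - w.1, z.2 - w.2)).
Proof.
move=> ck w.
have cz : {for w, continuous (fun w : R * R => z - w)}.
  by apply: cvgB; [exact: cvg_cst|exact: cvg_id].
exact: (continuous_comp cz (ck _)).
Qed.

(** The error depends on the measure through its mass only, hence is uniform along a sequence of
    bounded mass. *)
Lemma integral_conv_approx (R : realType) (mu : finite_measureC R) (K : set (R * R))
    (k k' : R * R -> R) (m : nat) (B M : R) :
  measurable (K : set (plane R)) ->
  measurable_fun setT (k : plane R -> R) -> measurable_fun setT (k' : plane R -> R) ->
  (forall u, `|k' u| <= B) ->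
  (forall u, (`|k u - k' u|%:E <= dyadic_pole m u)%E) ->
  (mu setT <= M%:E)%E ->
  (\int[area R]_(z in K) `|conv mu k z - conv mu k' z|%:E <= (16 / 2 ^+ m * M)%:E)%E.
Proof.
move=> mK mk mk' k'B kk' muM.
have mf : measurable_fun setT (fun p : plane R * plane R =>
    dyadic_pole m (p.1.1 - p.2.1, p.1.2 - p.2.2)%R).
  exact: (measurableT_comp (@measurable_dyadic_pole R m) (@measurable_diff R)).
have mF : measurable_fun setT (fun z : plane R =>
    \int[mu]_w dyadic_pole m (z.1 - w.1, z.2 - w.2)%R)%E.
  by apply: (measurable_fun_fubini_tonelli_F _ mf) => p; exact: dyadic_pole_ge0.
apply: (@le_trans _ _
    (\int[area R]_(z in K) \int[mu]_w dyadic_pole m (z.1 - w.1, z.2 - w.2)%R)%E).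
  apply: ge0_le_integral => //.
  - apply/measurable_EFinP; apply: measurable_funTS; apply: measurableT_comp => //.
    by apply: measurable_funB; exact: measurable_conv.
  - exact: measurable_funTS.
  - by move=> z _; apply: (conv_approx mu mk mk' k'B).
apply: (@le_trans _ _
    (\int[area R]_z \int[mu]_w dyadic_pole m (z.1 - w.1, z.2 - w.2)%R)%E).
  apply: ge0_subset_integral => //.
  by move=> z _; apply: integral_ge0 => w _; exact: dyadic_pole_ge0.
by rewrite integral_dyadic_pole [leRHS]EFinM lee_wpmul2l// lee_fin divr_ge0// exprn_ge0.
Qed.

(** The level m is fixed before n, because replacing k by [k_ m] costs the same for all the
    measures. At that level, w |-> [k_ m] (z - w) is a test function for each z, which gives
    pointwise convergence, and [B m * M] dominates. *)
Lemma conv_cvg_L1 (R : realType) (K : set (R * R)) (mu_ : nat -> finite_measureC R)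
    (mu : finite_measureC R) (M : R) (k : R * R -> R) (k_ : nat -> R * R -> R)
    (B : nat -> R) :
  compact K -> (forall n, mu_ n (~` K) = 0%E) -> mu (~` K) = 0%E ->
  (forall n, (mu_ n setT <= M%:E)%E) -> (mu setT <= M%:E)%E ->
  measurable_fun setT (k : plane R -> R) -> (forall m, continuous (k_ m)) ->
  (forall m u, `|k_ m u| <= B m) ->
  (forall m u, (`|k u - k_ m u|%:E <= dyadic_pole m u)%E) ->
  plane_weak_cvg K mu_ mu ->
  forall e : R, 0 < e -> \forall n \near \oo,
    (\int[area R]_(z in K) `|conv (mu_ n) k z - conv mu k z|%:E <= e%:E)%E.
Proof.
move=> cK muK_ muK muM_ muM mk ck kB kk_ wcvg e e0.
have mK := plane_compact_measurable cK.
have mk_ m := plane_continuous_measurable (ck m).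
have M0 : 0 <= M by rewrite -lee_fin (le_trans _ muM).
(* This makes each of the two replacement costs 16 M / 2^m at most e / 4; the middle term takes
   another e / 4. Using M + 1 avoids a division by zero. *)
have [m em] : exists m, 2 ^- m < e / (64 * (M + 1)).
  by apply: half_pow_lt; rewrite divr_gt0//; lra.
have em' : 16 / 2 ^+ m * M <= e / 4.
  have : 2 ^- m * (64 * (M + 1)) < e by rewrite -ltr_pdivlMr//; lra.
  have : 0 < 2 ^- m :> R by rewrite invr_gt0 exprn_gt0.
  by set t := 2 ^- m; nra.
have mc nu k1 : measurable_fun setT (k1 : plane R -> R) ->
  measurable_fun K (conv nu k1 : plane R -> R).
  by move=> mk1; apply: measurable_funTS; exact: measurable_conv.
have mabs nu1 nu2 k1 k2 : measurable_fun setT (k1 : plane R -> R) ->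
  measurable_fun setT (k2 : plane R -> R) ->
  measurable_fun K (fun z : plane R => `|conv nu1 k1 z - conv nu2 k2 z|%:E).
  move=> mk1 mk2; apply/measurable_EFinP; apply: measurableT_comp => //.
  by apply: measurable_funB; exact: mc.
have cv : (fun n => \int[area R]_(z in K)
    `|conv (mu_ n) (k_ m) z - conv mu (k_ m) z|%:E)%E @ \oo --> 0%E.
  have [] := @dominated_convergence _ _ R (area R) K mK
    (fun n z => (conv (mu_ n) (k_ m) z)%:E) (fun z => (conv mu (k_ m) z)%:E)
    (EFin \o cst (B m * M)).
  - by move=> n; apply/measurable_EFinP; exact: mc.
  - by apply/measurable_EFinP; exact: mc.
  - apply: aeW => z _; apply: cvg_EFin; first exact: nearW.
    have := wcvg _ (continuous_diffr (z := z) (ck m)).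
    have mz := plane_continuous_measurable (continuous_diffr (z := z) (ck m)).
    rewrite (Rintegral_support mK muK mz).
    by under eq_fun do rewrite (Rintegral_support mK (muK_ _) mz).
  - apply: measurable_bounded_integrable => //; first exact: compact_area_lty.
    exists `|B m * M|; split; first exact: num_real.
    move=> x Bx z _ /=. exact: ltW Bx.
  - by apply: aeW => z n _ /=; rewrite lee_fin; exact: conv_bounded.
  by [].
have cv' : \forall n \near \oo, (\int[area R]_(z in K)
    `|conv (mu_ n) (k_ m) z - conv mu (k_ m) z|%:E <= (e / 4)%:E)%E.
  have := cv [set x | x < (e / 4)%:E]%E; case.
    apply: open_nbhs_nbhs; split; first exact: open_ereal_lt_ereal.
    by rewrite /= lte_fin; lra.
  by move=> N _ hN; exists N => // n /hN /= /ltW.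
apply: filterS cv' => n hn.
apply: (@le_trans _ _ (\int[area R]_(z in K) (`|conv (mu_ n) k z - conv (mu_ n) (k_ m) z|%:E +
  `|conv (mu_ n) (k_ m) z - conv mu (k_ m) z|%:E + `|conv mu k z - conv mu (k_ m) z|%:E))%E).
  apply: ge0_le_integral => //.
  - exact: mabs.
  - by apply: emeasurable_funD; [apply: emeasurable_funD|]; exact: mabs.
  - move=> z _; rewrite -!EFinD lee_fin (le_trans (ler_distD (conv (mu_ n) (k_ m) z) _ _))//.
    by rewrite -addrA lerD2l (le_trans (ler_distD (conv mu (k_ m) z) _ _))// lerD2l distrC.
rewrite !ge0_integralD//; do ?exact: mabs; last 2 first.
- by move=> z _; rewrite -EFinD lee_fin addr_ge0.
- by apply: emeasurable_funD; exact: mabs.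
apply: (@le_trans _ _ ((16 / 2 ^+ m * M)%:E + (e / 4)%:E + (16 / 2 ^+ m * M)%:E)%E).
  by rewrite !leeD//; exact: integral_conv_approx.
by rewrite -!EFinD lee_fin; lra.
Qed.

(** * L^1 convergence of Cauchy transforms *)

Definition sqnorm (R : realType) (u : R * R) : R := u.1 ^+ 2 + u.2 ^+ 2.

Lemma sqnorm_continuous (R : realType) : continuous (@sqnorm R).
Proof.
move=> u; apply: cvgD; rewrite expr2; apply: cvgM.
all: by [exact: cvg_fst|exact: cvg_snd].
Qed.

(* The pole of the kernel [t / |u|^2] is removed by bounding the denominator
   below, which leaves the kernel unchanged outside the disc of radius 2^-m. *)
Definition cutoff (R : realType) (t : R * R -> R) (m : nat) (u : R * R) : R :=
  t u / Num.max (sqnorm u) ((2 ^- m) ^+ 2).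

Lemma cutoff_continuous (R : realType) (t : R * R -> R) (m : nat) :
  continuous t -> continuous (cutoff t m).
Proof.
move=> ct u; apply: cvgM; first exact: ct.
apply: cvgV; first by rewrite gt_eqF// lt_max [X in _ || X]exprn_gt0 ?orbT// invr_gt0 exprn_gt0.
apply: (@continuous_max R _ (@sqnorm R) (cst ((2 ^- m) ^+ 2))); first exact: sqnorm_continuous.
exact: cvg_cst.
Qed.

Section kernel.
Context (R : realType) (t : R * R -> R).
Hypothesis t2 : forall u, `|t u| ^+ 2 <= sqnorm u.

(** With e = 2^-m, the denominator d is at least |t u|^2 and at least e^2, hence at least |t u|
    e. *)
Lemma cutoff_bounded m u : `|cutoff t m u| <= 2 ^+ m.
Proof.
rewrite /cutoff; set e := 2 ^- m.
have e0 : 0 < e by rewrite invr_gt0 exprn_gt0.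
rewrite -[2 ^+ m]invrK -/e normrM.
set d := Num.max _ _.
have d1 : sqnorm u <= d by rewrite le_max lexx.
have d2 : e ^+ 2 <= d by rewrite le_max lexx orbT.
have d0 : 0 < d by rewrite (lt_le_trans _ d2)// exprn_gt0.
rewrite normfV (gtr0_norm d0) ler_pdivrMr// mulrC ler_pdivlMr//.
have := t2 u; have := normr_ge0 (t u); set s := `|t u|.
by nra.
Qed.

(** The difference lives where |u| < 2^-m and is at most |t u| / |u|^2 there. The choice x = |u|^2 /
    |t u| is admissible in [dyadic_pole_ge], since |u.1|, |u.2| and |t u| are all at most |u|. *)
Lemma cutoff_pole m u : (`|t u / sqnorm u - cutoff t m u|%:E <= dyadic_pole m u)%E.
Proof.
rewrite /cutoff; set e := 2 ^- m.
have e0 : 0 < e by rewrite invr_gt0 exprn_gt0.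
have [ue|ue] := leP (e ^+ 2) (sqnorm u).
  by rewrite subrr normr0 dyadic_pole_ge0.

have [t0|t0] := eqVneq (t u) 0.
  by rewrite t0 !mul0r subrr normr0 dyadic_pole_ge0.
have s0 : 0 < `|t u| by rewrite normr_gt0.
have n0 : 0 < sqnorm u by rewrite (lt_le_trans _ (t2 u))// exprn_gt0.
have x1 : `|u.1| ^+ 2 <= sqnorm u by rewrite real_normK ?num_real// lerDl sqr_ge0.
have x2 : `|u.2| ^+ 2 <= sqnorm u by rewrite real_normK ?num_real// lerDr sqr_ge0.
apply: (@le_trans _ _ ((sqnorm u / `|t u|)^-1%:E)).
  rewrite lee_fin -mulrBr normrM [leRHS]invf_div ler_wpM2l//.
  rewrite ger0_norm; first by rewrite gerBl invr_ge0 exprn_ge0// ltW.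
  by rewrite subr_ge0 lef_pV2 ?posrE ?exprn_gt0// ltW.
have lt_e (x : R) : 0 <= x -> x ^+ 2 <= sqnorm u -> x < e.
  by move=> ? ?; nra.
have le_q (x : R) : 0 <= x -> x ^+ 2 <= sqnorm u -> x <= sqnorm u / `|t u|.
  move=> ? ?; rewrite ler_pdivlMr//; have := t2 u; move: s0; set s := `|t u|; move=> ? ?.
  by nra.
apply: dyadic_pole_ge; [|exact: lt_e|exact: lt_e|exact: le_q|exact: le_q].
by apply/eqP => u0; move: n0; rewrite u0 /sqnorm/= expr0n/= addr0 ltxx.
Qed.

End kernel.

(** The identity holds at every z, atoms of mu included, because the inverse of 0 is 0 on both
    sides. *)
Lemma cauchy_transformE (R : realType) (mu : finite_measureC R) (z : R * R) :
  cauchy_transform mu (toC z) =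
  Complex (conv mu (fun u => u.1 / sqnorm u) z) (conv mu (fun u => - u.2 / sqnorm u) z).
Proof.
rewrite /cauchy_transform /integralC /conv; congr Complex; apply: eq_Rintegral => w _ //=.
by rewrite mulNr.
Qed.

Lemma measurable_kernel (R : realType) (t : R * R -> R) : continuous t ->
  measurable_fun setT ((fun u => t u / sqnorm u) : plane R -> R).
Proof.
move=> ct; apply: measurable_funM; first exact: plane_continuous_measurable.
apply: measurable_fun_inv; apply: plane_continuous_measurable; exact: sqnorm_continuous.
Qed.

Lemma fst_sqnorm (R : realType) (u : R * R) : `|u.1| ^+ 2 <= sqnorm u.
Proof. by rewrite real_normK ?num_real// lerDl sqr_ge0. Qed.

Lemma oppsnd_sqnorm (R : realType) (u : R * R) : `|- u.2| ^+ 2 <= sqnorm u.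
Proof. by rewrite normrN real_normK ?num_real// lerDr sqr_ge0. Qed.

Lemma oppsnd_continuous (R : realType) : continuous (fun u : R * R => - u.2).
Proof. by move=> u; apply: cvgN; exact: cvg_snd. Qed.

Lemma fst_continuous (R : realType) : continuous (fun u : R * R => u.1).
Proof. by move=> u; exact: cvg_fst. Qed.

Lemma measurable_cauchy_Re (R : realType) (mu : finite_measureC R) :
  measurable_fun setT ((fun z => complex.Re (cauchy_transform mu (toC z))) : plane R -> R).
Proof.
under eq_fun do rewrite cauchy_transformE/=.
by apply: measurable_conv; apply: measurable_kernel; exact: fst_continuous.
Qed.

Lemma measurable_cauchy_Im (R : realType) (mu : finite_measureC R) :
  measurable_fun setT ((fun z => complex.Im (cauchy_transform mu (toC z))) : plane R -> R).
Proof.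
under eq_fun do rewrite cauchy_transformE/=.
by apply: measurable_conv; apply: measurable_kernel; exact: oppsnd_continuous.
Qed.

Lemma cauchy_cvg_L1 (R : realType) (K : set (R * R)) (mu_ : nat -> finite_measureC R)
    (mu : finite_measureC R) (M : R) :
  compact K -> (forall n, mu_ n (~` K) = 0%E) -> mu (~` K) = 0%E ->
  (forall n, (mu_ n setT <= M%:E)%E) -> (mu setT <= M%:E)%E ->
  plane_weak_cvg K mu_ mu ->
  forall e : R, 0 < e -> \forall n \near \oo,
    (\int[area R]_(z in K) (`|complex.Re (cauchy_transform (mu_ n) (toC z)) -
        complex.Re (cauchy_transform mu (toC z))| +
      `|complex.Im (cauchy_transform (mu_ n) (toC z)) -
        complex.Im (cauchy_transform mu (toC z))|)%:E <= e%:E)%E.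
Proof.
move=> cK muK_ muK muM_ muM wcvg e e0.
have mK := plane_compact_measurable cK.
have e2 : 0 < e / 2 by rewrite divr_gt0.
have cv (t : R * R -> R) : continuous t -> (forall u, `|t u| ^+ 2 <= sqnorm u) ->
  \forall n \near \oo, (\int[area R]_(z in K) `|conv (mu_ n) (fun u => t u / sqnorm u) z -
    conv mu (fun u => t u / sqnorm u) z|%:E <= (e / 2)%:E)%E.
  move=> ct tn; apply: (conv_cvg_L1 (k_ := cutoff t) (B := fun m => 2 ^+ m)
    cK muK_ muK muM_ muM) => //.
  - exact: measurable_kernel.
  - by move=> m; exact: cutoff_continuous.
  - by move=> m u; exact: cutoff_bounded.
  - by move=> m u; exact: cutoff_pole.
have c1 := cv _ (@fst_continuous R) (@fst_sqnorm R).
have c2 := cv _ (@oppsnd_continuous R) (@oppsnd_sqnorm R).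
apply: filterS2 c1 c2 => n h1 h2.
under eq_integral do rewrite !cauchy_transformE/= EFinD.
have mk (t : R * R -> R) nu : continuous t ->
    measurable_fun setT (conv nu (fun u => t u / sqnorm u) : plane R -> R).
  by move=> ct; apply: measurable_conv; exact: measurable_kernel.
rewrite ge0_integralD//.
- by rewrite (splitr e) EFinD; exact: (leeD h1 h2).
- apply/measurable_EFinP/measurable_funTS/measurableT_comp => //.
  by apply: measurable_funB; apply: mk; exact: fst_continuous.
- apply/measurable_EFinP/measurable_funTS/measurableT_comp => //.
  by apply: measurable_funB; apply: mk; exact: oppsnd_continuous.
Qed.

(** Level 0 of the cutoff suffices: the difference of the convolutions has L^1 norm at most 16 M,
    and the truncated convolution is bounded by M on a set of finite area. *)
Lemma cauchy_integral_lty (R : realType) (K : set (R * R)) (mu : finite_measureC R) :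
  compact K ->
  (\int[area R]_(z in K) (`|complex.Re (cauchy_transform mu (toC z))| +
      `|complex.Im (cauchy_transform mu (toC z))|)%:E < +oo)%E.
Proof.
move=> cK; have mK := plane_compact_measurable cK.
pose M := fine (mu setT).
have muM : (mu setT <= M%:E)%E by rewrite fineK// fin_num_measure.
have M0 : 0 <= M by exact: fine_ge0.
have mk (t : R * R -> R) : continuous t ->
    measurable_fun setT (conv mu (fun u => t u / sqnorm u) : plane R -> R).
  by move=> ct; apply: measurable_conv; exact: measurable_kernel.
have mabs (f : plane R -> R) : measurable_fun setT f ->
    measurable_fun K (fun z : plane R => `|f z|%:E).
  by move=> mf; apply/measurable_EFinP/measurable_funTS/measurableT_comp.
have fin (t : R * R -> R) : continuous t -> (forall u, `|t u| ^+ 2 <= sqnorm u) ->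
    (\int[area R]_(z in K) `|conv mu (fun u => t u / sqnorm u) z|%:E < +oo)%E.
  move=> ct tn; set k := fun u => t u / sqnorm u.
  have mcut := plane_continuous_measurable (@cutoff_continuous R t 0 ct).
  have cutB := cutoff_bounded tn 0.
  apply: (@le_lt_trans _ _ (\int[area R]_(z in K)
      (`|conv mu k z - conv mu (cutoff t 0) z|%:E + (2 ^+ 0 * M)%:E))%E).
    apply: ge0_le_integral => //.
    - by apply: mabs; exact: mk.
    - apply: emeasurable_funD => //; apply: mabs.
      by apply: measurable_funB; [exact: mk|exact: measurable_conv].
    - move=> z _; rewrite -EFinD lee_fin -{1}(subrK (conv mu (cutoff t 0) z) (conv mu k z)).
      by rewrite (le_trans (ler_normD _ _))// lerD2l; apply: conv_bounded.
  rewrite ge0_integralD//; last 2 first.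
  - by apply: mabs; apply: measurable_funB; [exact: mk|exact: measurable_conv].
  - by move=> z _; rewrite lee_fin mulr_ge0.
  rewrite integral_cst// lte_add_pinfty//.
    apply: (@le_lt_trans _ _ (16 / 2 ^+ 0 * M)%:E); last exact: ltry.
    apply: (integral_conv_approx (B := 2 ^+ 0)) => //; first exact: measurable_kernel.
    by move=> u; exact: cutoff_pole.
  by rewrite lte_mul_pinfty// ?lee_fin ?mulr_ge0//; exact: compact_area_lty.
under eq_integral do rewrite !cauchy_transformE/= EFinD.
rewrite ge0_integralD//.
- by rewrite lte_add_pinfty//; apply: fin; [exact: fst_continuous|exact: fst_sqnorm|
    exact: oppsnd_continuous|exact: oppsnd_sqnorm].
- by apply: mabs; apply: mk; exact: fst_continuous.
- by apply: mabs; apply: mk; exact: oppsnd_continuous.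
Qed.

(** * Weak-* compactness *)

(** An ultrafilter finer than [\oo] provides the limits of all columns at once, by compactness of
    [-M, M]. Then [phi N] is any index beyond N at which the first N columns are within 1/(N+1) of
    their limits. The bound n <= phi n takes the place of strict monotonicity. *)
Lemma diagonal_subsequence (R : realType) (u : nat -> nat -> R) (M : R) :
  (forall n k, `|u n k| <= M) ->
  exists phi : nat -> nat, (forall n, (n <= phi n)%N) /\
    exists L : nat -> R, forall k, u (phi n) k @[n --> \oo] --> L k.
Proof.
move=> uM.
have [U [UU sU]] := @ultraFilterLemma nat \oo _.
have [L UL] : {L : nat -> R & forall k (e : R), 0 < e -> U [set n | `|u n k - L k| < e]}.
  apply: (@choice _ _ (fun k l => forall e : R, 0 < e -> U [set n | `|u n k - l| < e])) => k.
  have FP : ProperFilter (fmap (u^~ k) U) by apply: fmap_proper_filter.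
  have [|l [_ cl]] := @segment_compact R (- M) M (fmap (u^~ k) U) FP.
    rewrite /fmap/=; apply: filterS filterT => n _ /=.
    by rewrite in_itv/= -ler_norml.
  exists l => e e0.
  (* The ultrafilter contains the ball or its complement, and the complement would contradict that l
     is a cluster point. *)
  have [|Uc] := in_ultra_setVsetC [set n | ball l e (u n k)] UU.
    by apply: filterS => n /=; rewrite /ball/= distrC.
  have Fc : (fmap (u^~ k) U) (~` ball l e) by [].
  by have [x [/(_ _)]] := cl _ _ Fc (nbhsx_ballx l e e0).
have Un N : U [set n | (N <= n)%N /\ forall k, (k < N)%N -> `|u n k - L k| < N.+1%:R^-1].
  apply: filterI; first by apply: sU; exists N.
  have : forall m, U [set n | forall k, (k < m)%N -> `|u n k - L k| < N.+1%:R^-1].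
    elim=> [|m IH]; first by apply: filterS filterT.
    have Um := UL m N.+1%:R^-1; rewrite invr_gt0 ltr0n in Um.
    apply: filterS2 IH (Um isT) => n h1 h2 k.
    by rewrite ltnS leq_eqVlt => /orP[/eqP ->//|]; exact: h1.
  by apply.
have /choice[phi hphi] N : exists n,
    (N <= n)%N /\ forall k, (k < N)%N -> `|u n k - L k| < N.+1%:R^-1.
  exact: (filter_ex (Un N)).
exists phi; split; first by move=> n; have [] := hphi n.
exists L => k; apply/cvgrPdist_lt => e e0.
have [N _ hN] := near_infty_natSinv_lt (PosNum e0).
exists (maxn N k.+1) => // n /=; rewrite geq_max => /andP[Nn kn].
by rewrite distrC (lt_trans ((hphi n).2 _ kn))//; exact: hN.
Qed.

(* The binary digits of [code k z] record which of the first k rational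
   half-planes contain z, so that on a bounded set points with equal codes are
   close for k large. *)
Section codes.
Variable R : realType.

Definition half_plane (i : nat) : set (plane R) :=
  match (unpickle i : option (bool * rat)) with
  | Some (b, q) => [set z | (if b then z.1 else z.2) < ratr q]
  | None => set0
  end.

Fixpoint code (k : nat) (z : plane R) : nat :=
  if k is k'.+1 then ((z \in half_plane k') + (code k' z).*2)%N else 0%N.

Lemma code_half k z : (code k.+1 z)./2 = code k z.
Proof. by rewrite /= half_bit_double. Qed.

Lemma code_lt k z : (code k z < 2 ^ k)%N.
Proof.
elim: k => //= k IH; rewrite expnS mul2n.
case: (z \in _) => /=; last by rewrite add0n ltn_double.
by rewrite add1n ltn_Sdouble.
Qed.

Lemma measurable_half_plane i : measurable (half_plane i).
Proof.
rewrite /half_plane; case: unpickle => // -[[] q].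
- have := @measurable_fst _ _ (measurableTypeR R) (measurableTypeR R) measurableT
    `]-oo, ratr q[%classic (measurable_itv _).
  by rewrite setTI; congr measurable; apply/seteqP; split => z /=; rewrite in_itv.
- have := @measurable_snd _ _ (measurableTypeR R) (measurableTypeR R) measurableT
    `]-oo, ratr q[%classic (measurable_itv _).
  by rewrite setTI; congr measurable; apply/seteqP; split => z /=; rewrite in_itv.
Qed.

Lemma measurable_code k j : measurable [set z | code k z = j].
Proof.
elim: k j => [|k IH] j /=.
  have [->|j0] := eqVneq j 0%N.
    by rewrite (_ : [set _ | _] = setT)//; apply/seteqP.
  rewrite (_ : [set _ | _] = set0)//; apply/seteqP; split => // z /=.
  by move=> /esym/eqP; rewrite (negbTE j0).
rewrite (_ : [set _ | _] = [set z | code k z = j./2] `&`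
   (if odd j then half_plane k else ~` half_plane k)).
  apply: measurableI => //; case: ifP => _; first exact: measurable_half_plane.
  by apply: measurableC; exact: measurable_half_plane.
apply/seteqP; split => z /=.
  move=> <-; rewrite half_bit_double oddD odd_double addbF; split => //.
  by case: (boolP (z \in half_plane k)) => /=; [rewrite inE|rewrite notin_setE].
move=> [-> hj]; rewrite -[RHS]odd_double_half; congr (_ + _)%N.
by case: (odd j) hj => hz; [rewrite mem_set|rewrite memNset].
Qed.

Lemma code_eq_half_plane k z z' : code k z = code k z' ->
  forall i, (i < k)%N -> half_plane i z -> half_plane i z'.
Proof.
elim: k => // k IH e i; rewrite ltnS leq_eqVlt => /orP[/eqP ->|ik].
  have := congr1 odd e; rewrite /= !oddD !odd_double !addbF.
  move=> h zk; rewrite -in_setE; move: h; rewrite mem_set// => h.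
  by case: (z' \in _) h.
by apply: IH => //; rewrite -(code_half k z) -(code_half k z') e.
Qed.

(** The thresholds i/N - N with i < 2N^2 form a grid of mesh 1/N < e on [-N, N], an interval that
    contains [-r, r]. The level k exceeds the index of every half-plane of this grid, so equal codes
    mean that no grid line separates the two points. *)
Lemma code_mesh (r e : R) : 0 < e -> exists k, forall z z',
  `|z.1| < r -> `|z.2| < r -> `|z'.1| < r -> `|z'.2| < r -> code k z = code k z' ->
  `|z.1 - z'.1| < e /\ `|z.2 - z'.2| < e.
Proof.
move=> e0; pose N := (Num.truncn (`|r| + e^-1)).+1.
have Nb : `|r| + e^-1 < N%:R by exact: truncnS_gt.
have N0 : 0 < N%:R :> R by rewrite ltr0n.
have Nr : r < N%:R by rewrite (le_lt_trans (ler_norm r))// (lt_trans _ Nb)// ltrDl invr_gt0.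
have Ne : N%:R^-1 < e.
  by rewrite invf_plt ?posrE// (le_lt_trans _ Nb)// lerDr.
pose q (i : nat) : rat := i%:R / N%:R - N%:R.
pose k := (\max_(i < 2 * N * N) maxn (pickle (true, q i)).+1 (pickle (false, q i)).+1)%N.
exists k => z z' z1 z2 z1' z2' zz'.
have gap (x y : R) : `|x| < r -> `|y| < r -> e <= y - x ->
  exists2 i, (i < 2 * N * N)%N & x < ratr (q i) <= y.
  move=> xr yr xy; set i0 := Num.truncn ((x + N%:R) * N%:R).
  have xN0 : 0 <= (x + N%:R) * N%:R.
    by move: xr; rewrite ltr_norml => /andP[xr _]; rewrite mulr_ge0//; lra.
  have /andP[i1 i2] := truncn_itv xN0; rewrite -/i0 in i1 i2.
  have i1' : i0%:R / N%:R <= x + N%:R by rewrite ler_pdivrMr.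
  (* [q i0.+1] is the first threshold to the right of x, at distance at most 1/N from it, hence not
     beyond y. *)
  exists i0.+1.
    rewrite -(ltr_nat R) -natr1 !natrM -ltr_pdivrMr// mulrDl mul1r.
    by move: yr; rewrite ltr_norml => /andP[_ yr]; lra.
  rewrite /q rmorphB fmorph_div /= !ratr_nat; apply/andP; split.
    by rewrite ltrBrDr ltr_pdivlMr.
  by rewrite -natr1 mulrDl mul1r; lra.
have sep (b : bool) (w w' : plane R) : code k w = code k w' ->
    `|if b then w.1 else w.2| < r -> `|if b then w'.1 else w'.2| < r ->
    (if b then w'.1 else w'.2) - (if b then w.1 else w.2) < e.
  move=> ww' wr wr'; rewrite ltNge; apply/negP => /(gap _ _ wr wr')[i iN /andP[wi iw']].
  have : half_plane (pickle (b, q i)) w' .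
    apply: (code_eq_half_plane ww'); last by rewrite /half_plane pickleK.
    apply: leq_trans (leq_bigmax (Ordinal iN)) => /=.
    by case: b {wr wr' wi iw'}; rewrite leq_max leqnn ?orbT.
  by rewrite /half_plane pickleK/= ltNge iw'.
have s1 := sep true _ _ zz' z1 z1'; have s1' := sep true _ _ (esym zz') z1' z1.
have s2 := sep false _ _ zz' z2 z2'; have s2' := sep false _ _ (esym zz') z2' z2.
by rewrite !ltr_norml; split; lra.
Qed.

End codes.

(** * Uniform continuity and step approximation of integrals *)

(** The radius d is the parameter of the near-covering form of compactness: near a point x, half of
    a continuity radius at x serves. The point w is not confined to K. *)
Lemma compact_uniform_continuous (R : realType) (K : set (R * R)) (g : R * R -> R) (e : R) :
  compact K -> continuous g -> 0 < e -> exists2 d : R, 0 < d &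
    forall z w, K z -> `|z.1 - w.1| < d -> `|z.2 - w.2| < d -> `|g z - g w| <= e.
Proof.
move=> cK cg e0.
have /compact_near_coveringP/(_ R (0 : R)^'+
  (fun d z => forall w, `|z.1 - w.1| < d -> `|z.2 - w.2| < d -> `|g z - g w| <= e) _) := cK.
case.
  move=> x _.
  have e2 : 0 < e / 2 by rewrite divr_gt0.
  have /cvgrPdist_lt/(_ _ e2)/nbhs_ballP[d /= d0 xd] := cg x.
  have d2 : 0 < d / 2 by rewrite divr_gt0.
  exists (ball x (d / 2), [set i | i < d / 2]).
    split; first exact: nbhsx_ballx.
    exact: nbhs_right_lt.
  move=> [z i] /= [[xz1 xz2] id] w zw1 zw2.
  rewrite /ball/= in xz1 xz2.
  have gz : `|g x - g z| < e / 2.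
    by apply: xd; split; rewrite /ball/=; lra.
  have gw : `|g x - g w| < e / 2.
    apply: xd; split; rewrite /ball/=.
      by apply: le_lt_trans (ler_distD z.1 _ _) _; lra.
    by apply: le_lt_trans (ler_distD z.2 _ _) _; lra.
  apply: le_trans (ler_distD (g x) _ _) _; rewrite distrC; lra.
move=> d /= d0 hd; exists (d / 2); first by rewrite divr_gt0.
move=> z w Kz zw1 zw2; apply: (hd (d / 2)) => //=; last by rewrite divr_gt0.
by rewrite sub0r normrN gtr0_norm ?divr_gt0//; lra.
Qed.

Lemma continuous_bounded_compact (R : realType) (K : set (R * R)) (g : R * R -> R) :
  compact K -> continuous g -> exists B, forall z, K z -> `|g z| <= B.
Proof.
move=> cK cg.
have /compact_bounded[b [_ hb]] := continuous_compact (continuous_subspaceT cg) cK.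
exists (`|b| + 1) => z Kz; apply: (hb (`|b| + 1)); last by exists z.
by rewrite (le_lt_trans (ler_norm _))// ltrDl.
Qed.

Section step.
Context d (X : measurableType d) (R : realType) (nu : {measure set X -> \bar R}).
Variables (E : set X) (f : X -> R) (c : X -> nat) (h : nat -> R) (e : R).
Hypotheses (mE : measurable E) (Efin : (nu E < +oo)%E).
Hypotheses (fint : nu.-integrable E (EFin \o f)).
Hypotheses (mc : forall j, measurable (E `&` [set x | c x = j])).
Hypotheses (fh : forall x, E x -> `|f x - h (c x)| <= e).

(** E is the disjoint union of N fibres of c, on each of which f is within e of a constant; the
    induction adds one fibre at a time, through the sets [F n]. *)
Lemma step_integral N : (forall x, E x -> (c x < N)%N) ->
  `|\int[nu]_(x in E) f x - \sum_(j < N) h j * fine (nu (E `&` [set x | c x = j]))|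
    <= e * fine (nu E).
Proof.
move=> cN.
pose F n := E `&` [set x | (c x < n)%N].
have F0 : F 0%N = set0 by apply/seteqP; split => x //= [].
have FS n : F n.+1 = F n `|` (E `&` [set x | c x = n]).
  apply/seteqP; split => [x [Ex /=]|x [[Ex /= cx]|[Ex /= cx]]].
  - by rewrite ltnS leq_eqVlt => /orP[/eqP|]; [right|left].
  - by split => //=; rewrite ltnS ltnW.
  - by split => //=; rewrite cx.
have mF n : measurable (F n).
  elim: n => [|n IH]; first by rewrite F0.
  by rewrite FS; exact: measurableU.
have FE n : F n `<=` E by move=> x [].
have sub_fin A : measurable A -> A `<=` E -> nu A \is a fin_num.
  move=> mA AE; rewrite ge0_fin_numE// (le_lt_trans _ Efin)//.
  by apply: le_measure; rewrite ?inE.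
have sub_int A : measurable A -> A `<=` E -> nu.-integrable A (EFin \o f).
  by move=> mA AE; apply: integrableS fint.
have FdE n : F n `&` (E `&` [set x | c x = n]) = set0.
  by apply/seteqP; split => x //= [[_ /= cx] [_ cn]]; rewrite cn ltnn in cx.
have main n : `|\int[nu]_(x in F n) f x -
    \sum_(j < n) h j * fine (nu (E `&` [set x | c x = j]))| <= e * fine (nu (F n)).
  elim: n => [|n IH].
    by rewrite F0 Rintegral_set0 big_ord0 subrr normr0 measure0 mulr0.
  have En := mc n; set G := E `&` [set x | c x = n] in En *.
  have GE : G `<=` E by move=> x [].
  rewrite big_ord_recr/= FS -/G Rintegral_setU//; last 2 first.
  - by apply: sub_int; [exact: measurableU|rewrite subUset].
  - by apply/disj_setPS; rewrite FdE.
  rewrite measureU// ?fineD ?sub_fin// mulrDr opprD addrACA.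
  apply: (le_trans (ler_normD _ _)); rewrite lerD//.
  rewrite -[h n * _]Rintegral_cst//.
  have ic (r : R) : nu.-integrable G (EFin \o cst r).
    apply: measurable_bounded_integrable => //.
      by rewrite -ge0_fin_numE// sub_fin.
    by exists `|r|; split; [exact: num_real|move=> x rx y _ /=; exact: ltW].
  rewrite -RintegralB//; [|exact: sub_int|exact: ic].
  have ifh : nu.-integrable G (EFin \o (fun x => f x - h n)).
    have := integrableB En (sub_int _ En GE) (ic (h n)).
    by apply: eq_integrable.
  apply: (le_trans (le_normr_Rintegral _ _)) => //.
  rewrite -Rintegral_cst//; apply: le_Rintegral => //.
  - exact: integrable_norm.
  - exact: ic.
  - by move=> x [Ex /= <-]; exact: fh.
have FNE : F N = E by apply/seteqP; split => [x []//|x Ex]; split => //=; exact: cN.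
have := main N.
by rewrite FNE.
Qed.

End step.

(* A nonnegative function on the binary tree, additive from a vertex to its
   two children, cuts [0, L 0 0[ into nested half-open intervals. *)
Section tree.
Variable R : realType.
Variable L : nat -> nat -> R.
Hypothesis L0 : forall k j, 0 <= L k j.
Hypothesis LS : forall k j, L k j = L k.+1 j.*2 + L k.+1 j.*2.+1.
Hypothesis Lout : forall j, (0 < j)%N -> L 0 j = 0.

Definition offset k j := \sum_(i < j) L k i.

Lemma offsetS k j : offset k j.+1 = offset k j + L k j.
Proof. by rewrite /offset big_ord_recr. Qed.

Lemma offset_double k j : offset k.+1 j.*2 = offset k j.
Proof.
elim: j => [|j IH]; first by rewrite /offset !big_ord0.
by rewrite doubleS !offsetS IH -addrA -LS.
Qed.

Lemma offset_le k i j : (i <= j)%N -> offset k i <= offset k j.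
Proof.
move=> /subnK <-; elim: (j - i)%N => [|n IH]; first by rewrite add0n.
by rewrite addSn offsetS (le_trans IH)// lerDl.
Qed.

Lemma offset_total k : offset k (2 ^ k) = L 0 0.
Proof.
elim: k => [|k IH]; first by rewrite expn0 offsetS /offset big_ord0 add0r.
by rewrite expnS mul2n offset_double.
Qed.

(** A binary search for the interval that contains t: the new digit tells whether t lies beyond the
    left end of the right child. It obeys the same halving rule as [code], which lets the two be
    matched level by level. *)
Fixpoint tcode (k : nat) (t : R) : nat :=
  if k is k'.+1 then
    ((offset k (tcode k' t).*2.+1 <= t)%R + (tcode k' t).*2)%N
  else 0%N.

Lemma tcode_half k t : (tcode k.+1 t)./2 = tcode k t.
Proof. by rewrite /= half_bit_double. Qed.

Lemma tcode_itv k t : 0 <= t -> t < L 0 0 ->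
  offset k (tcode k t) <= t < offset k (tcode k t).+1.
Proof.
move=> t0 tL; elim: k => [|k /andP[IH1 IH2]].
  by rewrite /= offsetS /offset big_ord0 add0r t0.
rewrite [tcode k.+1 t]/=; case: (leP (offset k.+1 (tcode k t).*2.+1) t) => h /=.
  rewrite add1n h/=; move: IH2.
  by rewrite -(offset_double k (tcode k t).+1) doubleS.
by rewrite add0n h andbT offset_double.
Qed.

(** The intervals of one level are consecutive and fill [0, L 0 0[, so by monotonicity of [offset]
    the position of t determines the vertex. *)
Lemma tcode_fiber k j : `[0, L 0 0[%classic `&` [set t | tcode k t = j] =
  (if (j < 2 ^ k)%N then `[offset k j, offset k j.+1[%classic else set0) :> set R.
Proof.
have off0 : offset k 0 = 0 by rewrite /offset big_ord0.
apply/seteqP; split => t /=.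
  rewrite in_itv/= => -[/andP[t0 tL] <-].
  have /andP[t1 t2] := tcode_itv k t0 tL.
  case: ltnP => [_|kt]; first by rewrite /= in_itv/= t1.
  by have := offset_le k kt; rewrite offset_total => /le_trans/(_ t1); rewrite leNgt tL.
case: ltnP => //= jk; rewrite !in_itv/= => /andP[t1 t2].
have t0 : 0 <= t by rewrite (le_trans _ t1)// -off0 offset_le.
have tL : t < L 0 0 by rewrite (lt_le_trans t2)// -(offset_total k) offset_le.
split; first by rewrite t0 tL.
have /andP[t1' t2'] := tcode_itv k t0 tL.
apply/eqP; rewrite eqn_leq; apply/andP; split; rewrite leqNgt; apply/negP => h.
  by have := offset_le k h; rewrite leNgt (le_lt_trans t1' t2).
by have := offset_le k h; rewrite leNgt (le_lt_trans t1 t2').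
Qed.

Lemma tcode_lt k t : 0 <= t -> t < L 0 0 -> (tcode k t < 2 ^ k)%N.
Proof.
move=> t0 tL; rewrite ltnNge; apply/negP => kt.
have /andP[t1 t2] := tcode_itv k t0 tL.
by have := offset_le k kt; rewrite offset_total => /le_trans/(_ t1); rewrite leNgt tL.
Qed.

Lemma measurable_tcode k j :
  measurable (`[0, L 0 0[%classic `&` [set t | tcode k t = j] : set (measurableTypeR R)).
Proof. by rewrite tcode_fiber; case: ifP => _ //; exact: measurable_itv. Qed.

(** Zero passes from a vertex to its children, since these are nonnegative and add up to it; each
    vertex in question descends from a root of positive index. *)
Lemma L_out k j : (2 ^ k <= j)%N -> L k j = 0.
Proof.
elim: k j => [|k IH] j; first by rewrite expn0; exact: Lout.
rewrite expnS mul2n => kj.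
have kj2 : (2 ^ k <= j./2)%N by rewrite -(doubleK (2 ^ k)%N) half_leq.
have := LS k j./2; rewrite IH// => /esym/eqP.
rewrite paddr_eq0// => /andP[/eqP h1 /eqP h2].
by rewrite -(odd_double_half j); case: (odd j).
Qed.

Lemma lebesgue_tcode k j :
  lebesgue_measure (`[0, L 0 0[%classic `&` [set t | tcode k t = j] : set R) = (L k j)%:E.
Proof.
rewrite tcode_fiber; case: ltnP => jk; last by rewrite measure0 L_out.
rewrite lebesgue_measure_itv/= lte_fin offsetS ltrDl.
have := L0 k j; rewrite le_eqVlt => /predU1P[<-|->]; first by rewrite ltxx.
by rewrite -EFinB addrC addKr.
Qed.

End tree.

(* The measure is the law, under Lebesgue measure on [0, L 0 0[, of the limit of
   the step functions sending the interval of the vertex (k, j) to p k j. *)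
Section tree_measure.
Variables (R : realType) (K : set (R * R)) (L : nat -> nat -> R).
Variable p : nat -> nat -> plane R.
Hypothesis cK : compact K.
Hypothesis L0 : forall k j, 0 <= L k j.
Hypothesis LS : forall k j, L k j = L k.+1 j.*2 + L k.+1 j.*2.+1.
Hypothesis Lout : forall j, (0 < j)%N -> L 0 j = 0.
Hypothesis pK : forall k j, 0 < L k j -> K (p k j) /\ code k (p k j) = j.

Let D : set (measurableTypeR R) := `[0, L 0 0[%classic.

Let mD : measurable D. Proof. exact: measurable_itv. Qed.

Let x k t := p k (tcode L k t).

(** The interval that contains t is nonempty, so L is positive at its vertex. Vertices of zero mass,
    whose sample point may be meaningless, are never reached. *)
Let xP k t : D t -> K (x k t) /\ code k (x k t) = tcode L k t.
Proof.
rewrite /D/= in_itv/= => /andP[t0 tL].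
have /andP[t1 t2] := tcode_itv LS k t0 tL; apply: pK.
by rewrite offsetS in t2; rewrite -(ltrDl (offset L k (tcode L k t))) (le_lt_trans t1).
Qed.

(** Halving a code drops its last digit, so a sample point of level l keeps the codes prescribed at
    all earlier levels. With [code_mesh] this makes the sample points uniformly Cauchy. *)
Let x_code k l t : (k <= l)%N -> D t -> code k (x l t) = tcode L k t.
Proof.
move=> kl Dt; have [_] := xP l Dt; rewrite -(subnK kl); move: (x _ t) => z.
elim: (l - k)%N => [|n IH]; first by rewrite add0n.
by rewrite addSn => /(congr1 half); rewrite code_half tcode_half => /IH.
Qed.

Let x_mesh (e : R) : 0 < e -> exists k, forall l t, (k <= l)%N -> D t ->
  `|(x l t).1 - (x k t).1| < e /\ `|(x l t).2 - (x k t).2| < e.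
Proof.
move=> e0; have [r r0 Kr] := compact_box cK; have [k hk] := code_mesh r e0.
exists k => l t kl Dt; have [Kl _] := xP l Dt; have [Kk _] := xP k Dt.
by have [? ?] := Kr _ Kl; have [? ?] := Kr _ Kk; apply: hk => //; rewrite !x_code.
Qed.

(** The step function f (x k t) as a finite sum of indicators, which makes its measurability
    evident; being 0 outside D, it converges at every t. *)
Let y (f : plane R -> R) k t : R :=
  \sum_(j < 2 ^ k) f (p k j) * \1_(D `&` [set t | tcode L k t = j]) t.

Let y_in f k t : D t -> y f k t = f (x k t).
Proof.
move=> Dt; have : (tcode L k t < 2 ^ k)%N.
  by move: Dt; rewrite /D/= in_itv/= => /andP[? ?]; apply: tcode_lt.
move=> h; rewrite /y (bigD1 (Ordinal h))//= indicE mem_set// mulr1 big1 ?addr0// => j jt.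
rewrite indicE memNset ?mulr0// => -[_ /= tj]; move/eqP : jt; apply.
by apply/val_inj; rewrite /= tj.
Qed.

Let y_out f k t : ~ D t -> y f k t = 0.
Proof.
by move=> Dt; rewrite /y big1// => j _; rewrite indicE memNset ?mulr0// => -[].
Qed.

Let measurable_y f k : measurable_fun setT (y f k : measurableTypeR R -> R).
Proof.
apply: measurable_sum => j; apply: measurable_funM => //.
by apply: measurable_indic; exact: measurable_tcode.
Qed.

Let y_cvg (f : plane R -> R) t : (forall e, 0 < e -> exists k, forall l, (k <= l)%N -> D t ->
  `|f (x l t) - f (x k t)| < e) -> cvgn (y f ^~ t).
Proof.
move=> fx; have [Dt|Dt] := pselect (D t); last first.
  rewrite (_ : y f ^~ t = cst 0); first exact: is_cvg_cst.
  by apply/funext => k; rewrite y_out.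
apply: cauchy_cvg; apply: cauchy_exP => e e0.
have [k hk] := fx e e0; exists (f (x k t)), k => // l /= kl.
by rewrite /ball/= y_in// distrC; exact: hk.
Qed.

Let y1 t : cvgn (y fst ^~ t).
Proof.
apply: y_cvg => e e0; have [k hk] := x_mesh e0.
by exists k => l kl Dt; have [] := hk l t kl Dt.
Qed.

Let y2 t : cvgn (y snd ^~ t).
Proof.
apply: y_cvg => e e0; have [k hk] := x_mesh e0.
by exists k => l kl Dt; have [] := hk l t kl Dt.
Qed.

Let X (t : measurableTypeR R) : plane R := (limn (y fst ^~ t), limn (y snd ^~ t)).

Let mX : measurable_fun setT X.
Proof.
apply: measurable_fun_pair.
- by apply: (measurable_fun_cvg (h := y fst)) => [k|t _]; [exact: measurable_y|exact: y1].
- by apply: (measurable_fun_cvg (h := y snd)) => [k|t _]; [exact: measurable_y|exact: y2].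
Qed.

Let X_near (e : R) : 0 < e -> exists k, forall l t, (k <= l)%N -> D t ->
  `|(X t).1 - (x l t).1| < e /\ `|(X t).2 - (x l t).2| < e.
Proof.
move=> e0; have e3 : 0 < e / 3 by rewrite divr_gt0.
have [k hk] := x_mesh e3; exists k => l t kl Dt.
have [d1 d2] := hk l t kl Dt.
have c1 : `|(X t).1 - (x k t).1| <= e / 3.
  have c : `|y fst n t - (x k t).1| @[n --> \oo] --> `|(X t).1 - (x k t).1|.
    by apply: cvg_norm; apply: cvgB; [exact: y1|exact: cvg_cst].
  apply: (cvgr_to_le c); exists k => // n /= kn.
  by rewrite y_in// ltW//; have [] := hk n t kn Dt.
have c2 : `|(X t).2 - (x k t).2| <= e / 3.
  have c : `|y snd n t - (x k t).2| @[n --> \oo] --> `|(X t).2 - (x k t).2|.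
    by apply: cvg_norm; apply: cvgB; [exact: y2|exact: cvg_cst].
  apply: (cvgr_to_le c); exists k => // n /= kn.
  by rewrite y_in// ltW//; have [] := hk n t kn Dt.
rewrite distrC in d1; rewrite distrC in d2.
split.
- by apply: le_lt_trans (ler_distD (x k t).1 _ _) _; lra.
- by apply: le_lt_trans (ler_distD (x k t).2 _ _) _; lra.
Qed.

Let XK t : D t -> K (X t).
Proof.
move=> Dt; apply: contrapT => XnK.
have oK : open (~` K).
  by apply: closed_openC; apply: compact_closed => //; exact: norm_hausdorff.
have /nbhs_ballP[e /= e0 eK] : nbhs (X t : R * R) (~` K) by exact: open_nbhs_nbhs.
have [k hk] := X_near e0; have [h1 h2] := hk k t (leqnn k) Dt.
have [Kx _] := xP k Dt; exact: (eK (x k t)) Kx.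
Qed.

Let nu := mrestr (@lebesgue_measure R) mD.

Let nuD A : nu A = lebesgue_measure (A `&` D). Proof. by []. Qed.

Let lebD : lebesgue_measure D = (L 0 0)%:E.
Proof.
rewrite lebesgue_measure_itv/= lte_fin.
have := L0 0 0; rewrite le_eqVlt => /predU1P[<-|->]; first by rewrite ltxx.
by rewrite -EFinB subr0.
Qed.

Let mu0 : {measure set (plane R) -> \bar R}.
Proof. unshelve refine (pushforward nu X : {measure set (plane R) -> \bar R}); exact: mX. Defined.

Let mu0E A : mu0 A = nu (X @^-1` A). Proof. by []. Qed.

Let mu0_fin : fin_num_fun mu0.
Proof.
move=> A mA; rewrite mu0E nuD ge0_fin_numE//.
apply: (@le_lt_trans _ _ (lebesgue_measure D)); last by rewrite lebD ltry.
apply: le_measure; rewrite ?inE//.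
by apply: measurableI => //; rewrite -[X in measurable X]setTI; exact: mX.
Qed.

Let mu : finite_measureC R :=
  HB.pack (Measure.sort mu0) (Measure_isFinite.Build _ _ _ mu0 mu0_fin).

Lemma tree_measure : exists mu : finite_measureC R,
  [/\ mu (~` K) = 0%E, mu setT = (L 0 0)%:E &
   forall g : R * R -> R, continuous g -> forall e : R, 0 < e ->
   exists k, forall l, (k <= l)%N ->
   `|\int[mu]_(z in K) g z - \sum_(j < 2 ^ l) g (p l j) * L l j| <= e * L 0 0].
Proof.
have mK := plane_compact_measurable cK.
exists mu; split.
- rewrite -[LHS]/(nu (X @^-1` (~` K))) nuD (_ : _ `&` _ = set0) ?measure0//.
  by apply/seteqP; split => // t [/= h Dt]; apply: h; exact: XK.
- by rewrite -[LHS]/(nu (X @^-1` setT)) nuD preimage_setT setTI.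
move=> g cg e e0.
have [d d0 gd] := compact_uniform_continuous cK cg e0.
(* The step functions converge to X uniformly on D. From level k on, g (X t) is thus within e of g
   at the sample point of the interval containing t, and that interval has length given by L. *)
have [k hk] := X_near d0; exists k => l kl.
have mg := plane_continuous_measurable cg.
have mgX : measurable_fun setT (g \o X) by exact: (measurableT_comp mg mX).
have mE : measurable (X @^-1` K) by rewrite -[X in measurable X]setTI; exact: mX.
have nuE A : measurable A -> (nu A < +oo)%E.
  move=> mA; apply: (@le_lt_trans _ _ (lebesgue_measure D)); last by rewrite lebD ltry.
  by apply: le_measure; rewrite ?inE//; exact: measurableI.
have DE : D `<=` X @^-1` K by move=> t Dt; exact: XK.
have [B gB] := continuous_bounded_compact cK cg.
have intE : nu.-integrable (X @^-1` K) (EFin \o (g \o X)).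
  apply: measurable_bounded_integrable => //; [exact: nuE|exact: measurable_funTS|].
  exists B; split; first exact: num_real.
  by move=> b Bb t /= Kt; exact: le_trans (gB _ Kt) (ltW Bb).
have intD : nu.-integrable D (EFin \o (g \o X)) by exact: integrableS intE.
have -> : \int[mu]_(z in K) g z = \int[nu]_(t in D) g (X t).
  congr fine; rewrite -[LHS]/(\int[pushforward nu X]_(z in K) (g z)%:E)%E.
  rewrite integral_pushforward//; last exact/measurable_EFinP.
  (* [nu] is carried by D, which X maps into K, so the part of the preimage outside D is
     discarded. *)
  rewrite (@negligible_integral _ _ _ nu (X @^-1` K) (~` D))//.
  - by rewrite setDE setCK setIC; move/setIidPl : DE => ->.
  - exact: measurableC.
  - by rewrite /nu/= /mrestr setICl measure0.
have nucell j : fine (nu (D `&` [set t | tcode L l t = j])) = L l j.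
  by rewrite /nu/= /mrestr setIAC setIid lebesgue_tcode.
have gX t : D t -> `|(g \o X) t - g (p l (tcode L l t))| <= e.
  by move=> Dt; have [h1 h2] := hk l t kl Dt; apply: gd => //; exact: XK.
have cN t : D t -> (tcode L l t < 2 ^ l)%N.
  by rewrite /D/= in_itv/= => /andP[? ?]; exact: tcode_lt.
have := step_integral (h := fun j => g (p l j)) mD (nuE D mD) intD
  (measurable_tcode L0 LS l) gX cN.
under eq_bigr do rewrite nucell.
by rewrite /nu/= /mrestr setIid lebD/=.
Qed.

End tree_measure.

(** * Extraction of weakly convergent subsequences *)

Lemma continuous_integrable_compact (R : realType) (mu : finite_measureC R)
    (K : set (R * R)) (g : R * R -> R) :
  compact K -> continuous g -> mu.-integrable K (EFin \o (g : plane R -> R)).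
Proof.
move=> cK cg; have mK := plane_compact_measurable cK.
have [B gB] := continuous_bounded_compact cK cg.
apply: measurable_bounded_integrable => //.
- by rewrite ltey_eq fin_num_measure.
- by apply: measurable_funTS; exact: plane_continuous_measurable.
exists B; split; first exact: num_real.
by move=> b Bb t /= Kt; exact: le_trans (gB _ Kt) (ltW Bb).
Qed.

(** Additivity on the tree passes to the limits of the cell masses, and [tree_measure] asks for no
    more. Convergence is then read off Riemann sums over the cells of one fixed level, where only
    finitely many masses have to converge. *)
Lemma weak_compactness (R : realType) (K : set (R * R)) (mu_ : nat -> finite_measureC R)
    (M : R) :
  compact K -> (forall n, mu_ n (~` K) = 0%E) -> (forall n, (mu_ n setT <= M%:E)%E) ->
  exists (phi : nat -> nat) (mu : finite_measureC R),
    [/\ forall n, (n <= phi n)%N, mu (~` K) = 0%E, (mu setT <= M%:E)%E &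
        plane_weak_cvg K (mu_ \o phi) mu].
Proof.
move=> cK muK muM; have mK := plane_compact_measurable cK.
pose cell k j : set (plane R) := K `&` [set z | code k z = j].
have mcell k j : measurable (cell k j) by apply: measurableI => //; exact: measurable_code.
pose m n k j := fine (mu_ n (cell k j)).
have le_fine n (A B : set (plane R)) : measurable A -> measurable B -> A `<=` B ->
    fine (mu_ n A) <= fine (mu_ n B).
  move=> mA mB AB; apply: fine_le; rewrite ?fin_num_measure//.
  by apply: le_measure; rewrite ?inE.
have fineM n A : measurable A -> fine (mu_ n A) <= M.
  move=> mA; apply: (le_trans (le_fine n A setT _ _ _)) => //.
  by rewrite -lee_fin fineK ?fin_num_measure.
have m0 n k j : 0 <= m n k j by exact: fine_ge0.
have mM n k j : `|m n k j| <= M by rewrite ger0_norm// fineM.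
have mS n k j : m n k j = m n k.+1 j.*2 + m n k.+1 j.*2.+1.
  rewrite -fineD ?fin_num_measure// -measureU//; last first.
    by apply/seteqP; split => z // [[_ /= h1] [_ /= h2]]; rewrite h1 in h2; lia.
  congr (fine (mu_ n _)); apply/seteqP; split => [z [Kz /= cz]|z [] [Kz cz]].
  - case: (boolP (z \in @half_plane R k)) => hz; [right|left]; split => //=.
      by rewrite hz cz.
    by rewrite (negbTE hz) cz.
  - by split => //=; rewrite -code_half cz doubleK.
  - by split => //=; rewrite -code_half cz /= uphalf_double.
have M0 : 0 <= M by rewrite (le_trans (m0 0 0 0)%N)// fineM.
pose u n i := if (unpickle i : option (nat * nat)) is Some (k, j) then m n k j else 0.
have uM n i : `|u n i| <= M by rewrite /u; case: unpickle => [[k j]|]; rewrite ?normr0.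
have [phi [phin [L' uL]]] := diagonal_subsequence uM.
pose L (k j : nat) := L' (pickle (k, j)).
have mL k j : m (phi n) k j @[n --> \oo] --> L k j.
  by have := uL (pickle (k, j)); rewrite /u pickleK.
have L0 k j : 0 <= L k j by apply: (cvgr_to_ge (mL k j)); exact: nearW.
have LS k j : L k j = L k.+1 j.*2 + L k.+1 j.*2.+1.
  have h1 : m (phi n) k j @[n --> \oo] --> L k.+1 j.*2 + L k.+1 j.*2.+1.
    under eq_fun do rewrite mS; apply: cvgD; exact: mL.
  exact: (cvg_unique (@Rhausdorff R) (mL k j) h1).
have empty k j : cell k j = set0 -> L k j = 0.
  move=> e0; have h1 : m (phi n) k j @[n --> \oo] --> (0 : R).
    by rewrite /m e0; under eq_fun do rewrite measure0; exact: cvg_cst.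
  exact: (cvg_unique (@Rhausdorff R) (mL k j) h1).
have Lout j : (0 < j)%N -> L 0%N j = 0.
  by move=> j0; apply: empty; apply/seteqP; split => // z [_ /= jz]; rewrite -jz in j0.
(* A sample point of the cell. The default (0, 0) occurs only for an empty cell, whose limit mass is
   0. *)
pose p (k j : nat) : plane R := xget (0, 0) (cell k j).
have pcell k j z : cell k j z -> K (p k j) /\ code k (p k j) = j.
  by move=> cz; have := xgetI (0, 0) cz.
have pK k j : 0 < L k j -> K (p k j) /\ code k (p k j) = j.
  move=> Lkj; have [e0|/set0P[z]] := eqVneq (cell k j) set0; last exact: pcell.
  by rewrite (empty _ _ e0) ltxx in Lkj.
have [mu [mu1 mu2 mu3]] := tree_measure cK L0 LS Lout pK.
have LM : L 0%N 0%N <= M.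
  by apply: (cvgr_to_le (mL 0 0)%N); apply: nearW => n; exact: fineM.
exists phi, mu; split => //; first by rewrite mu2 lee_fin.
move=> g cg; apply/cvgrPdist_le => e e0.
(* Three errors are added: at most e' M for the limit measure, e' for the convergence of the Riemann
   sums, and e' M for the measure of the sequence. *)
pose e' := e / (2 * M + 1).
have e'0 : 0 < e' by rewrite divr_gt0//; lra.
have [k1 hk1] := mu3 g cg e' e'0.
have [d d0 gd] := compact_uniform_continuous cK cg e'0.
have [r r0 Kr] := compact_box cK; have [k2 hk2] := code_mesh r d0.
pose k := maxn k1 k2.
have code_le l (z z' : plane R) : (k2 <= l)%N -> code l z = code l z' -> code k2 z = code k2 z'.
  move=> /subnK <-; elim: (l - k2)%N => [|n IH]; first by rewrite add0n.
  by rewrite addSn => /(congr1 half); rewrite !code_half => /IH.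
have gp z : K z -> `|g z - g (p k (code k z))| <= e'.
  move=> Kz; have [|Kp cp] := pcell k (code k z) z; first by split.
  have [z1 z2] := Kr _ Kz; have [p1 p2] := Kr _ Kp.
  have [h1 h2] := hk2 _ _ z1 z2 p1 p2 (code_le k _ _ (leq_maxr _ _) (esym cp)).
  exact: gd.
have step n : `|\int[mu_ n]_(z in K) g z - \sum_(j < 2 ^ k) g (p k j) * m n k j| <= e' * M.
  have := step_integral (nu := mu_ n) (h := fun j => g (p k j)) mK _
     (continuous_integrable_compact _ cK cg) (mcell k) gp (fun z _ => code_lt k z).
  move=> /(_ _)/le_trans; apply; first by rewrite ltey_eq fin_num_measure.
  by apply: ler_wpM2l; [exact: ltW|exact: fineM].
have sumL : \sum_(j < 2 ^ k) g (p k j) * m (phi n) k j @[n --> \oo] -->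
    \sum_(j < 2 ^ k) g (p k j) * L k j.
  apply: cvg_big => [|j _]; first exact: add_continuous.
  apply: cvgM; first exact: cvg_cst.
  exact: mL.
have /cvgrPdist_le/(_ e' e'0) := sumL.
apply: filterS => n hn.
have h1 := hk1 k (leq_maxl _ _); have h2 := step (phi n).
have h3 : e' * L 0%N 0%N <= e' * M by rewrite ler_wpM2l// ltW.
apply: le_trans (ler_distD (\sum_(j < 2 ^ k) g (p k j) * L k j) _ _) _.
apply: le_trans (lerD (le_trans h1 h3)
  (ler_distD (\sum_(j < 2 ^ k) g (p k j) * m (phi n) k j) _ _)) _.
rewrite distrC in h2.
apply: le_trans (lerD (lexx _) (lerD hn h2)) _.
have -> : e = e' * (2 * M + 1) by rewrite /e' divfK// gt_eqF//; lra.
by lra.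
Qed.

(** * Laurent coefficients and moments *)

Section complex_parts.
Variable R : realType.
Implicit Types x y : R[i].

Lemma ReM x y : complex.Re (x * y) =
  complex.Re x * complex.Re y - complex.Im x * complex.Im y.
Proof. by case: x; case: y. Qed.

Lemma ImM x y : complex.Im (x * y) =
  complex.Re x * complex.Im y + complex.Im x * complex.Re y.
Proof. by case: x; case: y. Qed.

Lemma normc_normE x : `|x| = (Normc.normc x)%:C%C.
Proof. by rewrite normc_def; case: x. Qed.

Lemma normc_ge0 x : 0 <= Normc.normc x.
Proof. by case: x => a b; exact: sqrtr_ge0. Qed.

Lemma abs_Re_le_normc x : `|complex.Re x| <= Normc.normc x.
Proof. by rewrite -lecR -normc_normE; exact: normc_ge_Re. Qed.

Lemma abs_Im_le_normc x : `|complex.Im x| <= Normc.normc x.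
Proof.
by case: x => a b /=; rewrite -sqrtr_sqr ler_wsqrtr// lerDr sqr_ge0.
Qed.

Lemma normc_le_abs x : Normc.normc x <= `|complex.Re x| + `|complex.Im x|.
Proof.
case: x => a b /=; rewrite -[leRHS]ger0_norm ?addr_ge0// -sqrtr_sqr ler_wsqrtr//.
by rewrite sqrrD !real_normK ?num_real// lerD2r lerDl mulrn_wge0// mulr_ge0.
Qed.

Lemma normcX x n : Normc.normc (x ^+ n) = Normc.normc x ^+ n.
Proof.
elim: n => [|n IH]; first by rewrite !expr0 Normc.normc1.
by rewrite !exprS Normc.normcM IH.
Qed.

(** In R[i] the tolerance is itself a complex number, but a positive element has zero imaginary
    part, so real tolerances suffice. *)
Lemma cvg_normcP (u : nat -> R[i]) (l : R[i]) :
  ((u : nat -> R[i]^o) @ \oo --> (l : R[i]^o)) <->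
  (forall e : R, 0 < e -> \forall n \near \oo, Normc.normc (l - u n) < e).
Proof.
split=> [/cvgrPdist_lt cu e e0|cu].
  have /cu : 0 < e%:C%C by rewrite ltcR.
  by apply: filterS => n; rewrite normc_normE ltcR.
apply/cvgrPdist_lt => -[a b]; rewrite ltcE/= => /andP[/eqP -> a0].
by have := cu a a0; apply: filterS => n; rewrite normc_normE ltcR.
Qed.

Lemma cvg_Re (u : nat -> R[i]) (l : R[i]) :
  ((u : nat -> R[i]^o) @ \oo --> (l : R[i]^o)) ->
  complex.Re (u n) @[n --> \oo] --> complex.Re l.
Proof.
move=> /cvg_normcP cu; apply/cvgrPdist_lt => e /cu; apply: filterS => n.
by apply: le_lt_trans; rewrite -raddfB abs_Re_le_normc.
Qed.

Lemma cvg_Im (u : nat -> R[i]) (l : R[i]) :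
  ((u : nat -> R[i]^o) @ \oo --> (l : R[i]^o)) ->
  complex.Im (u n) @[n --> \oo] --> complex.Im l.
Proof.
move=> /cvg_normcP cu; apply/cvgrPdist_lt => e /cu; apply: filterS => n.
by apply: le_lt_trans; rewrite -raddfB abs_Im_le_normc.
Qed.

End complex_parts.

Section laurent_uniqueness.
Variable R : realType.

Lemma half_geometric_le (q : R) n : 0 <= q -> q <= 1 / 2 -> \sum_(i < n) q ^+ i <= 2.
Proof.
move=> q0 q2; suff : \sum_(i < n) q ^+ i <= 2 - 2 * q ^+ n.
  by move=> /le_trans; apply; rewrite lerBlDr lerDl mulr_ge0// exprn_ge0.
elim: n => [|n IH]; first by rewrite big_ord0 expr0; lra.
rewrite big_ord_recr/= exprS.
have : 0 <= q ^+ n by rewrite exprn_ge0.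
by nra.
Qed.

(** Strong induction: once the earlier coefficients vanish, the leading term is minus the tail,
    which is at most 2 B (t0/t)^(p+2) for t >= 2 t0. Hence |c p| is at most a constant over t, for t
    as large as desired. *)
Lemma laurent_eq0 (c : nat -> R) (r : R) :
  (forall t, r < t -> (fun n => \sum_(k < n) c k * t ^- k.+1) @ \oo --> (0 : R)) ->
  forall k, c k = 0.
Proof.
move=> sc; pose t0 := `|r| + 1.
have t0r : r < t0 by rewrite (le_lt_trans (ler_norm _))// ltrDl.
have t00 : 0 < t0 by rewrite ltr_wpDl.
(* Convergence at t0 bounds the partial sums, and each term is a difference of two consecutive
   ones. *)
have [B cB] : exists B, forall k, `|c k| <= B * t0 ^+ k.+1.
  have [A [_ hA]] := cvg_seq_bounded (cvgP _ (sc _ t0r)).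
  have {}hA n : `|\sum_(k < n) c k * t0 ^- k.+1| <= A + 1 by apply: hA => //; rewrite ltrDl.
  exists (2 * (A + 1)) => k.
  have := le_trans (ler_normB _ _) (lerD (hA k.+1) (hA k)).
  rewrite big_ord_recr/= addrAC subrr add0r normrM [X in _ * X]gtr0_norm ?invr_gt0 ?exprn_gt0//.
  by rewrite ler_pdivrMr ?exprn_gt0// mulr_natl mulr2n.
have B0 : 0 <= B.
  by have := le_trans (normr_ge0 _) (cB 0%N); rewrite expr1 pmulr_lge0.
move=> k; have [n] := ubnP k; elim: n k => // n IH p; rewrite ltnS => pn.
have cp0 j : (j < p)%N -> c j = 0 by move=> jp; apply: IH; exact: leq_trans pn.
have bound t : 2 * t0 <= t -> `|c p| <= 2 * B * t0 ^+ p.+2 / t.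
  move=> t2; have t_0 : 0 < t by lra.
  have tr : r < t by lra.
  have q0 : 0 <= t0 / t by rewrite divr_ge0// ltW.
  have q2 : t0 / t <= 1 / 2 by rewrite ler_pdivrMr//; lra.
  have tail n' : `|\sum_(k < p.+1 + n') c k * t ^- k.+1 - c p * t ^- p.+1| <=
      2 * B * (t0 / t) ^+ p.+2.
    rewrite big_split_ord/= big_ord_recr/= big1 ?add0r; last first.
      by move=> i _; rewrite cp0 ?mul0r.
    rewrite addrAC subrr add0r (le_trans (ler_norm_sum _ _ _))//.
    apply: (@le_trans _ _ (\sum_(i < n') B * (t0 / t) ^+ p.+2 * (t0 / t) ^+ i)).
      apply: ler_sum => i _; rewrite normrM.
      rewrite [X in _ * X]gtr0_norm ?invr_gt0 ?exprn_gt0//.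
      rewrite -mulrA -exprD expr_div_n mulrA ler_pM2r ?invr_gt0 ?exprn_gt0//.
    rewrite -mulr_sumr mulrAC ler_wpM2r ?exprn_ge0// mulrC ler_wpM2r//.
    exact: half_geometric_le.
  have lim : `|c p * t ^- p.+1| <= 2 * B * (t0 / t) ^+ p.+2.
    rewrite -normrN -[X in `|X|]add0r.
    have cv : `|\sum_(k < n') c k * t ^- k.+1 - c p * t ^- p.+1| @[n' --> \oo] -->
        `|0 - c p * t ^- p.+1|.
      by apply: cvg_norm; apply: cvgB; [exact: sc|exact: cvg_cst].
    apply: (cvgr_to_le cv); exists p.+1 => // n' /= pn'.
    by have := tail (n' - p.+1)%N; rewrite subnKC.
  move: lim; rewrite normrM [X in _ * X]gtr0_norm ?invr_gt0 ?exprn_gt0//.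
  rewrite ler_pdivrMr ?exprn_gt0// => /le_trans; apply.
  rewrite expr_div_n [t ^+ p.+2]exprS invfM -!mulrA.
  by rewrite mulVf ?mulr1// expf_neq0// gt_eqF.
apply/eqP; rewrite -normr_eq0 eq_le normr_ge0 andbT.
rewrite leNgt; apply/negP => cpp.
set C := 2 * B * t0 ^+ p.+2 in bound.
have C0 : 0 <= C by rewrite mulr_ge0 ?exprn_ge0 ?mulr_ge0// ltW.
have Ccp : 0 <= C / `|c p| by rewrite divr_ge0.
(* At this t, the inequality |c p| t <= C reads 2 t0 |c p| + C <= C, which is absurd. *)
have t_0 : 0 < 2 * t0 + C / `|c p| by lra.
have := bound (2 * t0 + C / `|c p|); rewrite lerDl => /(_ Ccp).
rewrite ler_pdivlMr// mulrDr [_ * (C / _)]mulrC divfK ?gt_eqF// gerDr.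
by rewrite leNgt mulr_gt0//; lra.
Qed.

End laurent_uniqueness.

(** * Measurability and integration of complex-valued functions *)

Section complex_measurable.
Variable R : realType.
Implicit Types h : plane R -> R[i].

Definition cmeasurable h :=
  measurable_fun setT (fun z => complex.Re (h z)) /\
  measurable_fun setT (fun z => complex.Im (h z)).

Lemma cmeasurable_cst (c : R[i]) : cmeasurable (fun=> c).
Proof. by split; exact: measurable_cst. Qed.

Lemma cmeasurable_toC : cmeasurable (@toC R).
Proof. by split; [exact: measurable_fst|exact: measurable_snd]. Qed.

Lemma cmeasurableD h1 h2 : cmeasurable h1 -> cmeasurable h2 ->
  cmeasurable (fun z => h1 z + h2 z).
Proof.
move=> [r1 i1] [r2 i2]; split.
- by under eq_fun do rewrite raddfD/=; exact: measurable_funD.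
- by under eq_fun do rewrite raddfD/=; exact: measurable_funD.
Qed.

Lemma cmeasurableM h1 h2 : cmeasurable h1 -> cmeasurable h2 ->
  cmeasurable (fun z => h1 z * h2 z).
Proof.
move=> [r1 i1] [r2 i2]; split.
- by under eq_fun do rewrite ReM; apply: measurable_funB; exact: measurable_funM.
- by under eq_fun do rewrite ImM; apply: measurable_funD; exact: measurable_funM.
Qed.

Lemma cmeasurableX h n : cmeasurable h -> cmeasurable (fun z => h z ^+ n).
Proof.
move=> ch; elim: n => [|n IH].
  by under eq_fun do rewrite expr0; exact: cmeasurable_cst.
by under eq_fun do rewrite exprS; exact: cmeasurableM.
Qed.

Lemma cmeasurableV h : cmeasurable h -> cmeasurable (fun z => (h z)^-1).
Proof.
move=> [rh ih].
have m2 : measurable_fun setT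
    (fun z => (complex.Re (h z) ^+ 2 + complex.Im (h z) ^+ 2)^-1).
  by apply: measurable_fun_inv; apply: measurable_funD; exact: measurable_funX.
have E z : (h z)^-1 = Complex
    (complex.Re (h z) * (complex.Re (h z) ^+ 2 + complex.Im (h z) ^+ 2)^-1)
    (- (complex.Im (h z) * (complex.Re (h z) ^+ 2 + complex.Im (h z) ^+ 2)^-1)).
  by case: (h z).
split.
- by under eq_fun do rewrite E/=; exact: measurable_funM.
- by under eq_fun do rewrite E/=; apply: measurable_funN; exact: measurable_funM.
Qed.

Lemma cmeasurable_sum n (h : 'I_n -> plane R -> R[i]) :
  (forall i, cmeasurable (h i)) -> cmeasurable (fun z => \sum_(i < n) h i z).
Proof.
elim: n h => [|n IH] h ch.
  by under eq_fun do rewrite big_ord0; exact: cmeasurable_cst.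
by under eq_fun do rewrite big_ord_recr/=; apply: cmeasurableD => //; exact: IH.
Qed.

End complex_measurable.

Section integralC.
Variables (R : realType) (mu : finite_measureC R) (K : set (R * R)) (M : R).
Hypothesis cK : compact K.
Hypothesis muK : mu (~` K) = 0%E.
Hypothesis muM : (mu setT <= M%:E)%E.
Implicit Types h : plane R -> R[i].

Let mK : measurable (K : set (plane R)). Proof. exact: plane_compact_measurable. Qed.

Definition cbounded h := exists B, forall z, K z -> Normc.normc (h z) <= B.

Let integrable_part (f : plane R -> R) (B : R) : measurable_fun setT f ->
  (forall z, K z -> `|f z| <= B) -> mu.-integrable K (EFin \o f).
Proof.
move=> mf fB; apply: measurable_bounded_integrable => //.
- by rewrite ltey_eq fin_num_measure.
- exact: measurable_funTS.
exists B; split; first exact: num_real.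
by move=> b Bb t /= Kt; exact: le_trans (fB _ Kt) (ltW Bb).
Qed.

Lemma integrable_Re h : cmeasurable h -> cbounded h ->
  mu.-integrable K (EFin \o (fun z => complex.Re (h z))).
Proof.
move=> [mh _] [B hB]; apply: (integrable_part (B := B)) => // z Kz.
by rewrite (le_trans (abs_Re_le_normc _))// hB.
Qed.

Lemma integrable_Im h : cmeasurable h -> cbounded h ->
  mu.-integrable K (EFin \o (fun z => complex.Im (h z))).
Proof.
move=> [_ mh] [B hB]; apply: (integrable_part (B := B)) => // z Kz.
by rewrite (le_trans (abs_Im_le_normc _))// hB.
Qed.

Lemma integralC_support h : cmeasurable h -> integralC mu h =
  Complex (\int[mu]_(z in K) complex.Re (h z)) (\int[mu]_(z in K) complex.Im (h z)).
Proof. by move=> [m1 m2]; rewrite /integralC !(Rintegral_support mK muK). Qed.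

Lemma eq_integralC h1 h2 : cmeasurable h1 -> cmeasurable h2 ->
  (forall z, K z -> h1 z = h2 z) -> integralC mu h1 = integralC mu h2.
Proof.
move=> m1 m2 h12; rewrite !integralC_support//.
by congr Complex; apply: eq_Rintegral => z; rewrite inE => Kz; rewrite h12.
Qed.

Lemma cboundedD h1 h2 : cbounded h1 -> cbounded h2 -> cbounded (fun z => h1 z + h2 z).
Proof.
move=> [A hA] [B hB]; exists (A + B) => z Kz.
by rewrite (le_trans (le_normcD _ _))// lerD ?hA ?hB.
Qed.

Lemma cboundedM h1 h2 : cbounded h1 -> cbounded h2 -> cbounded (fun z => h1 z * h2 z).
Proof.
move=> [A hA] [B hB]; exists (A * B) => z Kz.
by rewrite Normc.normcM ler_pM ?normc_ge0 ?hA ?hB.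
Qed.

Lemma cbounded_cst c : cbounded (fun=> c).
Proof. by exists (Normc.normc c). Qed.

Lemma cboundedX h n : cbounded h -> cbounded (fun z => h z ^+ n).
Proof.
move=> bh; elim: n => [|n IH].
  by under eq_fun do rewrite expr0; exact: cbounded_cst.
by under eq_fun do rewrite exprS; exact: cboundedM.
Qed.

Lemma cbounded_toC : cbounded (@toC R).
Proof.
have [r r0 Kr] := compact_box cK; exists (r + r) => z Kz.
have [? ?] := Kr _ Kz.
by rewrite (le_trans (normc_le_abs _))//= lerD ?ltW.
Qed.

Lemma integralCD h1 h2 : cmeasurable h1 -> cbounded h1 -> cmeasurable h2 -> cbounded h2 ->
  integralC mu (fun z => h1 z + h2 z) = integralC mu h1 + integralC mu h2.
Proof.
move=> m1 b1 m2 b2.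
have m12 := cmeasurableD m1 m2.
rewrite !integralC_support//.
transitivity (Complex (\int[mu]_(z in K) (complex.Re (h1 z) + complex.Re (h2 z)))
  (\int[mu]_(z in K) (complex.Im (h1 z) + complex.Im (h2 z)))).
  by congr Complex; apply: eq_Rintegral => z _; rewrite raddfD.
by rewrite !RintegralD//; 
  [exact: integrable_Im|exact: integrable_Im|exact: integrable_Re|exact: integrable_Re].
Qed.

Lemma integralCZ (c : R[i]) h : cmeasurable h -> cbounded h ->
  integralC mu (fun z => h z * c) = integralC mu h * c.
Proof.
move=> mh bh.
have mch := cmeasurableM mh (@cmeasurable_cst R c).
rewrite !integralC_support//.
have iR := integrable_Re mh bh; have iI := integrable_Im mh bh.
have iZ (f : plane R -> R) r : mu.-integrable K (EFin \o f) ->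
    mu.-integrable K (EFin \o (fun z => f z * r)).
  by move=> fi; have := integrableZr mK r fi; apply: eq_integrable.
case: c mch => a b mch; rewrite [RHS]/GRing.mul/=.
congr Complex.
- transitivity (\int[mu]_(z in K) (complex.Re (h z) * a - complex.Im (h z) * b)).
    by apply: eq_Rintegral => z _; rewrite ReM.
  by rewrite RintegralB ?RintegralZr//; exact: iZ.
- transitivity (\int[mu]_(z in K) (complex.Re (h z) * b + complex.Im (h z) * a)).
    by apply: eq_Rintegral => z _; rewrite ImM.
  by rewrite RintegralD ?RintegralZr//; exact: iZ.
Qed.

(** Boundedness of the partial sum belongs to the same induction, because additivity of the integral
    asks for it at each step. *)
Lemma integralC_sum n (h : 'I_n -> plane R -> R[i]) :
  (forall i, cmeasurable (h i)) -> (forall i, cbounded (h i)) ->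
  cbounded (fun z => \sum_(i < n) h i z) /\
  integralC mu (fun z => \sum_(i < n) h i z) = \sum_(i < n) integralC mu (h i).
Proof.
elim: n h => [|n IH] h mh bh.
  split; first by exists 0 => z _; rewrite big_ord0 Normc.normc0.
  have Z (f : R[i] -> R) : f 0 = 0 -> \int[mu]_z f (\sum_(i < 0) h i z) = 0.
    move=> f0; under eq_Rintegral do rewrite big_ord0 f0.
    by rewrite Rintegral_cst// mul0r.
  by rewrite big_ord0 /integralC !Z.
have [bS E] := IH (fun i => h (widen_ord (leqnSn n) i)) (fun=> mh _) (fun=> bh _).
have mS := cmeasurable_sum (fun i : 'I_n => mh (widen_ord (leqnSn n) i)).
have -> : (fun z : plane R => \sum_(i < n.+1) h i z) =
    (fun z => \sum_(i < n) h (widen_ord (leqnSn n) i) z + h ord_max z).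
  by apply/funext => z; rewrite big_ord_recr.
split; first exact: cboundedD.
by rewrite integralCD// E big_ord_recr.
Qed.

(** The factor 2 comes from bounding the real and imaginary parts separately. *)
Lemma normc_integralC_le h B : cmeasurable h -> (forall z, K z -> Normc.normc (h z) <= B) ->
  0 <= B -> Normc.normc (integralC mu h) <= 2 * B * M.
Proof.
move=> mh hB B0; have bh : cbounded h by exists B.
have main (f : plane R -> R) : mu.-integrable K (EFin \o f) ->
    (forall z, K z -> `|f z| <= B) -> `|\int[mu]_(z in K) f z| <= B * M.
  move=> fi fB; apply: (le_trans (le_normr_Rintegral mK fi)).
  have ic : mu.-integrable K (EFin \o cst B) by exact: finite_measure_integrable_cst.
  apply: (@le_trans _ _ (\int[mu]_(z in K) B)).
    by apply: le_Rintegral => //; exact: integrable_norm.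
  rewrite Rintegral_cst// ler_wpM2l// -lee_fin fineK ?fin_num_measure//.
  by rewrite (le_trans _ muM)// le_measure ?inE.
rewrite integralC_support// (le_trans (normc_le_abs _))//= -mulrA mulr_natl mulr2n.
apply: lerD; apply: main.
- exact: integrable_Re.
- by move=> z Kz; rewrite (le_trans (abs_Re_le_normc _))// hB.
- exact: integrable_Im.
- by move=> z Kz; rewrite (le_trans (abs_Im_le_normc _))// hB.
Qed.

End integralC.

(** * Moments and the expansion of the Cauchy transform at infinity *)

Definition moment (R : realType) (mu : finite_measureC R) (k : nat) : R[i] :=
  integralC mu (fun z => toC z ^+ k).

(** With an exact remainder only finite sums are integrated against the measure, and no exchange of
    limit and integral occurs. *)
Lemma geometric_remainder (F : fieldType) (z w : F) N : z != 0 -> z - w != 0 ->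
  (z - w)^-1 = \sum_(k < N) w ^+ k * z ^- k.+1 + w ^+ N * (z ^- N * (z - w)^-1).
Proof.
move=> z0 zw; elim: N => [|N IH]; first by rewrite big_ord0 !expr0 invr1 !mul1r add0r.
rewrite {1}IH big_ord_recr/= -addrA; congr (_ + _).
rewrite !exprS; set a := w ^+ N; set b := z ^+ N.
have b0 : b != 0 by rewrite expf_neq0.
by field; rewrite z0 zw b0.
Qed.

Lemma near_inftyI (R : realType) (p q : R[i] -> Prop) :
  near_infty p -> near_infty q -> near_infty (fun z => p z /\ q z).
Proof.
move=> [r hr] [s hs]; exists (Num.max r s) => z hz.
by split; [apply: hr|apply: hs]; apply: le_lt_trans hz; rewrite lecR le_max lexx ?orbT.
Qed.

Lemma near_infty_mono (R : realType) (p q : R[i] -> Prop) :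
  (forall z, p z -> q z) -> near_infty p -> near_infty q.
Proof. by move=> pq [r hr]; exists r => z /hr /pq. Qed.

(** Points w of K satisfy |w| <= 2r, so for |z| > 2r the remainder after N terms is at most q^N /
    dl, where q = 2r/|z| < 1 and dl = |z| - 2r bounds |z - w| from below. *)
Lemma cauchy_transform_expansion (R : realType) (mu : finite_measureC R) (K : set (R * R)) :
  compact K -> mu (~` K) = 0%E ->
  near_infty (fun z : R[i] =>
    (series (fun k => moment mu k * z ^- k.+1) : nat -> R[i]^o) @ \oo -->
      (cauchy_transform mu z : R[i]^o)).
Proof.
move=> cK muK; have [r r0 Kr] := compact_box cK.
pose M := fine (mu setT).
have muM : (mu setT <= M%:E)%E by rewrite fineK// fin_num_measure.
have M0 : 0 <= M by exact: fine_ge0.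
have Kn w : K w -> Normc.normc (toC w) <= 2 * r.
  move=> Kw; have [? ?] := Kr _ Kw.
  by rewrite (le_trans (normc_le_abs _))//= mulr_natl mulr2n lerD// ltW.
exists (2 * r) => z; rewrite normc_normE ltcR => rz.
have nz0 : 0 < Normc.normc z by rewrite (lt_trans _ rz)// mulr_gt0.
have z0 : z != 0 by apply: contraTneq nz0 => ->; rewrite Normc.normc0 ltxx.
set dl := Normc.normc z - 2 * r; have dl0 : 0 < dl by rewrite subr_gt0.
have zw w : K w -> dl <= Normc.normc (z - toC w).
  move=> Kw; rewrite lerBlDr -[X in Normc.normc X <= _](subrK (toC w)).
  by rewrite (le_trans (le_normcD _ _))// lerD2l Kn.
have zw0 w : K w -> z - toC w != 0.
  move=> Kw; apply: contraTneq (zw w Kw) => ->.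
  by rewrite Normc.normc0 -ltNge.
pose inv (w : plane R) := (z - toC w)^-1.
have minv : cmeasurable inv.
  apply: cmeasurableV; split.
    by under eq_fun do rewrite raddfB/=; apply: measurable_funB => //; exact: measurable_fst.
  by under eq_fun do rewrite raddfB/=; apply: measurable_funB => //; exact: measurable_snd.
have invB w : K w -> Normc.normc (inv w) <= dl^-1.
  by move=> Kw; rewrite Normc.normcV lef_pV2 ?posrE ?zw// (lt_le_trans _ (zw _ Kw)).
pose rem N (w : plane R) := toC w ^+ N * (inv w * z ^- N).
pose term k (w : plane R) := toC w ^+ k * z ^- k.+1.
have mterm k : cmeasurable (term k).
  by apply: cmeasurableM; [apply: cmeasurableX; exact: cmeasurable_toC|exact: cmeasurable_cst].
have bterm k : cbounded K (term k).
  by apply: cboundedM; [apply: cboundedX; exact: cbounded_toC|exact: cbounded_cst].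
have mrem N : cmeasurable (rem N).
  apply: cmeasurableM; first by apply: cmeasurableX; exact: cmeasurable_toC.
  by apply: cmeasurableM => //; exact: cmeasurable_cst.
pose q := 2 * r / Normc.normc z.
have q0 : 0 <= q by rewrite divr_ge0// ?normc_ge0// mulr_ge0// ltW.
have q1 : q < 1 by rewrite ltr_pdivrMr// mul1r.
have remB N w : K w -> Normc.normc (rem N w) <= q ^+ N * dl^-1.
  move=> Kw; rewrite /rem !Normc.normcM Normc.normcV !normcX /q expr_div_n -mulrA.
  rewrite [X in _ <= _ * X]mulrC.
  apply: ler_pM; rewrite ?exprn_ge0 ?normc_ge0 ?mulr_ge0 ?invr_ge0 ?exprn_ge0 ?normc_ge0//.
    by rewrite lerXn2r ?nnegrE ?normc_ge0 ?Kn// mulr_ge0// ltW.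
  rewrite [X in _ * X <= _]Normc.normcV normcX ler_wpM2r ?invr_ge0 ?exprn_ge0 ?normc_ge0//.
  by rewrite -Normc.normcV invB.
have brem N : cbounded K (rem N) by exists (q ^+ N * dl^-1); exact: remB.
have Et k : integralC mu (term k) = moment mu k * z ^- k.+1.
  by apply: (integralCZ cK muK); [apply: cmeasurableX; exact: cmeasurable_toC|
    apply: cboundedX; exact: cbounded_toC].
have split_N N : cauchy_transform mu z - series (fun k => moment mu k * z ^- k.+1) N =
    integralC mu (rem N).
  have [bS ES] := integralC_sum cK muK (fun i : 'I_N => mterm i) (fun i : 'I_N => bterm i).
  have mS := cmeasurable_sum (fun i : 'I_N => mterm i).
  have -> : cauchy_transform mu z = integralC mu (fun w => \sum_(i < N) term i w + rem N w).
    apply: (eq_integralC cK muK) => //; first exact: cmeasurableD.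
    move=> w Kw; rewrite (geometric_remainder N z0 (zw0 _ Kw)); congr (_ + _).
    by rewrite /rem /inv [_^-1 * z ^- N]mulrC.
  rewrite (integralCD cK muK)// ES /series/= big_mkord addrAC.
  under eq_bigr do rewrite Et.
  by rewrite subrr add0r.
apply/cvg_normcP => e e0.
have : (fun N => 2 * (q ^+ N * dl^-1) * M) @ \oo --> (0 : R).
  rewrite (_ : (fun _ => _) = (fun N => q ^+ N * (2 * dl^-1 * M))).
    rewrite -[X in _ --> X](mul0r (2 * dl^-1 * M)).
    by apply: cvgM; [apply: cvg_expr; rewrite ger0_norm|exact: cvg_cst].
  by apply/funext => N; ring.
move=> /cvgrPdist_lt/(_ e e0); apply: filterS => N; rewrite sub0r normrN => hN.
rewrite split_N; apply: le_lt_trans (le_lt_trans (ler_norm _) hN).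
apply: (normc_integralC_le cK muK muM) => //; first exact: remB.
by rewrite mulr_ge0 ?exprn_ge0// invr_ge0 ltW.
Qed.

(** On the positive real axis the difference of the two series splits into two real series, for the
    real and imaginary parts of its coefficients, to which [laurent_eq0] applies. *)
Lemma laurent_coef_uniq (R : realType) (a b : nat -> R[i]) (g : R[i] -> R[i]) :
  near_infty (fun z : R[i] =>
    (series (fun k => a k * z ^- k.+1) : nat -> R[i]^o) @ \oo --> (g z : R[i]^o)) ->
  near_infty (fun z : R[i] =>
    (series (fun k => b k * z ^- k.+1) : nat -> R[i]^o) @ \oo --> (g z : R[i]^o)) ->
  forall k, a k = b k.
Proof.
move=> ha hb; have [r hr] := near_inftyI ha hb.
pose c k := a k - b k.
have cv t : Num.max r 0 < t ->
    (series (fun k => c k * t%:C%C ^- k.+1) : nat -> R[i]^o) @ \oo --> (0 : R[i]^o).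
  rewrite gt_max => /andP[rt t0].
  have [] := hr t%:C%C _; first by rewrite normc_normE/= expr0n addr0 sqrtr_sqr gtr0_norm// ltcR.
  move=> h1 h2; rewrite -(subrr (g t%:C%C : R[i]^o)).
  rewrite (_ : series _ = (fun n => series (fun k => a k * t%:C%C ^- k.+1) n -
     series (fun k => b k * t%:C%C ^- k.+1) n)); first exact: cvgB.
  by apply/funext => n; rewrite /series/= -sumrB; apply: eq_bigr => k _; rewrite mulrBl.
have part k t : c k * t%:C%C ^- k.+1 =
    Complex (complex.Re (c k) * t ^- k.+1) (complex.Im (c k) * t ^- k.+1).
  rewrite -rmorphXn/= -fmorphV/=; case: (c k) => x y; rewrite [LHS]/GRing.mul/=.
  by rewrite !mulr0 subr0 add0r.
have c0 k : c k = 0.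
  have h1 : complex.Re (c k) = 0.
    apply: (laurent_eq0 (c := fun k => complex.Re (c k)) (r := Num.max r 0)) => t /cv/cvg_Re.
    rewrite raddf0; under eq_fun do rewrite /series/= raddf_sum big_mkord.
    by under eq_fun do under eq_bigr do rewrite part/=.
  have h2 : complex.Im (c k) = 0.
    apply: (laurent_eq0 (c := fun k => complex.Im (c k)) (r := Num.max r 0)) => t /cv/cvg_Im.
    rewrite raddf0; under eq_fun do rewrite /series/= raddf_sum big_mkord.
    by under eq_fun do under eq_bigr do rewrite part/=.
  by case: (c k) h1 h2 => x y /= -> ->.
by move=> k; apply/eqP; rewrite -subr_eq0; apply/eqP; exact: c0.
Qed.

Lemma representing_moments (R : realType) (f : germ R) (K : set (R * R))
    (mu : finite_measureC R) : compact K ->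
  representing f K mu -> forall k, moment mu k = germ_coef f k.
Proof.
move=> cK [muK muf].
apply: (laurent_coef_uniq (g := f)); last exact: germ_laurent.
have := near_inftyI muf (cauchy_transform_expansion cK muK).
by apply: near_infty_mono => z [<-].
Qed.

Lemma moments_representing (R : realType) (f : germ R) (K : set (R * R))
    (mu : finite_measureC R) : compact K -> mu (~` K) = 0%E ->
  (forall k, moment mu k = germ_coef f k) -> representing f K mu.
Proof.
move=> cK muK mom; split => //.
have := near_inftyI (germ_laurent f) (cauchy_transform_expansion cK muK).
apply: near_infty_mono => z []; under [X in series X]eq_fun do rewrite -mom.
by move=> h1 h2; exact: (cvg_unique (@norm_hausdorff _ _) h2 h1).
Qed.

(** * Continuity of the defect *)

Lemma uniform_cvg_normc (R : realType) (U : set (R * R)) (h_ : nat -> R * R -> R[i])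
    (h : R * R -> R[i]) :
  {uniform U, (fun n z => h_ n z : R[i]^o) @ \oo --> (fun z => h z : R[i]^o)} ->
  forall e : R, 0 < e -> \forall n \near \oo, forall z, U z ->
    Normc.normc (h z - h_ n z) < e.
Proof.
move=> cv e e0.
have e0C : 0 < e%:C%C by rewrite ltcR.
have := cv [set g | forall z, U z -> ball (h z : R[i]^o) e%:C%C (g z)]; case.
  apply/uniform_nbhs; exists [set xy | ball xy.1 e%:C%C xy.2]; split => //.
  exact: (@entourage_ball _ _ (PosNum e0C)).
move=> N _ hN; exists N => // n /hN /= hn z /hn.
by rewrite /ball/= normc_normE ltcR.
Qed.

Section root.
Variables (R : realType) (d : nat).
Hypothesis d0 : (0 < d)%N.
Implicit Types a b u v x y : R.

Lemma exprD_ge x y : 0 <= x -> 0 <= y -> x ^+ d + y ^+ d <= (x + y) ^+ d.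
Proof.
move=> x0 y0; case: d d0 => // n _; elim: n => [|n IH]; first by rewrite !expr1.
rewrite [leRHS]exprS; apply: le_trans (_ : (x + y) * (x ^+ n.+1 + y ^+ n.+1) <= _).
  rewrite mulrDl !mulrDr -!exprS.
  have : 0 <= x * y ^+ n.+1 by rewrite mulr_ge0 ?exprn_ge0.
  have : 0 <= y * x ^+ n.+1 by rewrite mulr_ge0 ?exprn_ge0.
  by lra.
by rewrite ler_wpM2l// addr_ge0.
Qed.

Lemma powR_invK u : 0 <= u -> (u `^ d%:R^-1) ^+ d = u.
Proof.
by move=> u0; rewrite -powR_mulrn ?powR_ge0// -powRrM mulVf ?powRr1// pnatr_eq0 -lt0n.
Qed.

(** Subadditivity of the d-th root, in a form that absorbs errors given as d-th powers: raise to the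
    power d and use [exprD_ge] twice. *)
Lemma root_le_add u v a b : 0 <= u -> 0 <= v -> 0 <= a -> 0 <= b ->
  u <= v + (a ^+ d + b ^+ d) -> u `^ d%:R^-1 <= v `^ d%:R^-1 + (a + b).
Proof.
move=> u0 v0 a0 b0 uv; have vr := powR_ge0 v d%:R^-1.
rewrite -(@ler_pXn2r _ d)// ?nnegrE ?powR_ge0 ?addr_ge0//.
rewrite powR_invK// (le_trans uv)// -{1}(powR_invK v0).
apply: le_trans (exprD_ge vr (addr_ge0 a0 b0)).
by rewrite lerD2l exprD_ge.
Qed.

End root.

Section eval.
Variable R : realType.

Lemma eval2E (d : nat) (P : {poly {poly R[i]}}) (z w : R[i]) : size P = d.+1 ->
  eval2 P z w = \sum_(j < d.+1) (P`_j).[z] * w ^+ j.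
Proof.
move=> sP; rewrite /eval2 (horner_coef P) sP horner_sum; apply: eq_bigr => j _.
by rewrite hornerM horner_exp hornerC.
Qed.

Lemma normc_sum_le n (F : 'I_n -> R[i]) :
  Normc.normc (\sum_(i < n) F i) <= \sum_(i < n) Normc.normc (F i).
Proof.
elim: n F => [|n IH] F; first by rewrite !big_ord0 Normc.normc0.
by rewrite !big_ord_recr/= (le_trans (le_normcD _ _))// lerD2r.
Qed.

Lemma cbounded_horner (K : set (R * R)) (p : {poly R[i]}) : compact K ->
  exists B, forall z, K z -> Normc.normc p.[toC z] <= B.
Proof.
move=> cK; have [r r0 Kr] := compact_box cK.
exists (\sum_(i < size p) Normc.normc p`_i * (2 * r) ^+ i) => z Kz.
have Kn : Normc.normc (toC z) <= 2 * r.
  have [? ?] := Kr _ Kz.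
  by rewrite (le_trans (normc_le_abs _))//= mulr_natl mulr2n lerD// ltW.
rewrite horner_coef (le_trans (normc_sum_le _))//; apply: ler_sum => i _.
rewrite Normc.normcM normcX ler_wpM2l ?normc_ge0//.
by rewrite lerXn2r ?nnegrE ?normc_ge0// mulr_ge0// ltW.
Qed.

(** The mean value bound j |w' - w| W^(j-1), multiplied by W so that the exponent j - 1 does not
    appear and j = 0 is no exception. *)
Lemma normc_subX (w w' : R[i]) (W : R) j :
  Normc.normc w <= W -> Normc.normc w' <= W ->
  W * Normc.normc (w' ^+ j - w ^+ j) <= j%:R * Normc.normc (w' - w) * W ^+ j.
Proof.
move=> wW wW'; have W0 : 0 <= W := le_trans (normc_ge0 _) wW.
set D := Normc.normc (w' - w); have D0 : 0 <= D := normc_ge0 _.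
elim: j => [|j IH]; first by rewrite !expr0 subrr Normc.normc0 mulr0 !mul0r.
have -> : w' ^+ j.+1 - w ^+ j.+1 = w' * (w' ^+ j - w ^+ j) + (w' - w) * w ^+ j.
  by rewrite !exprS; ring.
have h1 := le_normcD (w' * (w' ^+ j - w ^+ j)) ((w' - w) * w ^+ j).
rewrite !Normc.normcM normcX -/D in h1.
have h2 : Normc.normc w ^+ j <= W ^+ j by rewrite lerXn2r ?nnegrE ?normc_ge0.
apply: (le_trans (ler_wpM2l W0 h1)).
rewrite mulrDr mulrCA -[j.+1%:R]natr1 !mulrDl mul1r exprS.
apply: lerD.
  apply: le_trans (ler_wpM2l (normc_ge0 w') IH) _.
  by rewrite [leRHS]mulrCA ler_wpM2r// !mulr_ge0// exprn_ge0.
by rewrite [leRHS]mulrCA !ler_wpM2l.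
Qed.

End eval.

Section root_close.
Variables (R : realType) (K : set (R * R)) (d : nat).
Variables (P_ : nat -> {poly {poly R[i]}}) (P : {poly {poly R[i]}}).
Hypotheses (cK : compact K) (d0 : (0 < d)%N).
Hypotheses (sP_ : forall n, size (P_ n) = d.+1) (sP : size P = d.+1).
Hypothesis PU : forall j, (j <= d)%N ->
    exists2 U : set (R * R), set_nbhs K U &
      {uniform U, (fun n (z : R * R) => ((P_ n)`_j).[toC z] : R[i]^o) @ \oo -->
                  (fun z : R * R => (P`_j).[toC z] : R[i]^o)}.

Lemma coef_close (e : R) : 0 < e -> \forall n \near \oo, forall (j : 'I_d.+1) z, K z ->
  Normc.normc ((P`_j).[toC z] - ((P_ n)`_j).[toC z]) <= e.
Proof.
move=> e0; apply: filter_forall => j.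
have [U /set_nbhsP[C [_ KC CU]] cv] := PU (leq_ord j).
have := uniform_cvg_normc cv e0; apply: filterS => n hn z /KC/CU/hn.
exact: ltW.
Qed.

(** Varying w produces a mixed term |w - w'| W^(d-1), with W = 1 + |w| + |w'|. It is traded for e
    W^d + e (|w - w'|/e)^d, two d-th powers whose roots are linear; the constant C depends on P and
    K only. *)
Lemma eval2_close : exists2 C : R, 0 <= C &
  forall e eta : R, 0 < e -> 0 < eta -> \forall n \near \oo, forall z (w w' : R[i]), K z ->
    Normc.normc (eval2 P (toC z) w - eval2 (P_ n) (toC z) w') <=
    (d.+1%:R * eta + C * e) * (1 + Normc.normc w + Normc.normc w') ^+ d +
    C * e * (Normc.normc (w - w') / e) ^+ d.
Proof.
have /choice[B hB] (j : 'I_d.+1) := cbounded_horner P`_j cK.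
pose Bt := \sum_j `|B j|.
have Bt0 : 0 <= Bt by exact: sumr_ge0.
exists (Bt * d%:R) => [|e eta e0 eta0]; first by rewrite mulr_ge0.
have := coef_close eta0; apply: filterS => n hn z w w' Kz; set W := 1 + _ + _.
have W1 : 1 <= W by rewrite /W; have := normc_ge0 w; have := normc_ge0 w'; lra.
have W0 : 0 < W by lra.
have wW : Normc.normc w <= W by rewrite /W; have := normc_ge0 w; have := normc_ge0 w'; lra.
have wW' : Normc.normc w' <= W by rewrite /W; have := normc_ge0 w; have := normc_ge0 w'; lra.
set D := Normc.normc (w - w'); have D0 : 0 <= D := normc_ge0 _.
have h1 : Normc.normc (eval2 P (toC z) w' - eval2 (P_ n) (toC z) w') <= d.+1%:R * eta * W ^+ d.
  rewrite (eval2E _ _ sP) (eval2E _ _ (sP_ n)) -sumrB (le_trans (normc_sum_le _))//.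
  apply: (@le_trans _ _ (\sum_(j < d.+1) eta * W ^+ d)); last first.
    by rewrite sumr_const card_ord -[leLHS]mulr_natl mulrA.
  apply: ler_sum => j _; rewrite -mulrBl Normc.normcM normcX.
  apply: ler_pM; rewrite ?normc_ge0 ?exprn_ge0 ?normc_ge0//; first exact: hn.
  apply: (@le_trans _ _ (W ^+ j)); first by rewrite lerXn2r ?nnegrE ?normc_ge0 ?(ltW W0).
  by rewrite ler_weXn2l// leq_ord.
have h2 : W * Normc.normc (eval2 P (toC z) w - eval2 P (toC z) w') <= Bt * d%:R * D * W ^+ d.
  rewrite !(eval2E _ _ sP) -sumrB (le_trans (ler_wpM2l (ltW W0) (normc_sum_le _)))// mulr_sumr.
  rewrite -!mulrA mulr_suml; apply: ler_sum => j _.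
  rewrite -mulrBr Normc.normcM mulrCA; apply: ler_pM;
    rewrite ?normc_ge0 ?mulr_ge0 ?normc_ge0 ?(ltW W0)//.
    by rewrite (le_trans (hB j z Kz))// ler_norm.
  apply: (le_trans (normc_subX j wW' wW)); rewrite -mulrA; apply: ler_pM => //.
  - by rewrite mulr_ge0 ?normc_ge0 ?exprn_ge0// ltW.
  - by rewrite ler_nat leq_ord.
  - by rewrite ler_wpM2l ?normc_ge0// ler_weXn2l// leq_ord.
set X := Normc.normc (eval2 P (toC z) w - eval2 P (toC z) w') in h2.
have h3 : X <= Bt * d%:R * e * W ^+ d + Bt * d%:R * e * (D / e) ^+ d.
  set C := Bt * d%:R in h2 *; have C0 : 0 <= C by rewrite mulr_ge0.
  (* If D <= e W, one factor D is replaced by e W; otherwise W <= D / e, and every remaining factor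
     W is replaced by D / e. *)
  have [De|De] := leP D (e * W).
    apply: (@le_trans _ _ (C * e * W ^+ d)); last first.
      by rewrite lerDl mulr_ge0 ?exprn_ge0 ?divr_ge0 ?mulr_ge0 ?(ltW e0).
    rewrite -(ler_pM2l W0) (le_trans h2)// [leRHS]mulrA ler_wpM2r ?exprn_ge0 ?(ltW W0)//.
    have -> : W * (C * e) = C * (e * W) by ring.
    by rewrite ler_wpM2l.
  apply: (@le_trans _ _ (C * e * (D / e) ^+ d)); last first.
    by rewrite lerDr mulr_ge0 ?exprn_ge0 ?mulr_ge0 ?(ltW e0) ?(ltW W0).
  have WD : W <= D / e by rewrite ler_pdivlMr// mulrC ltW.
  rewrite -(ler_pM2l W0) (le_trans h2)//.
  case: d d0 => // d' _; rewrite !exprS.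
  have : W ^+ d' <= (D / e) ^+ d' by rewrite lerXn2r ?nnegrE ?(ltW W0) ?divr_ge0 ?(ltW e0).
  set a := W ^+ d'; set b := (D / e) ^+ d' => ab.
  have -> : C * D * (W * a) = W * (C * D * a) by ring.
  rewrite ler_wpM2l ?(ltW W0)//.
  have -> : C * e * (D / e * b) = C * D * b by field; rewrite gt_eqF.
  by rewrite ler_wpM2l// mulr_ge0.
rewrite -(subrKA (eval2 P (toC z) w')) (le_trans (le_normcD _ _))// -/X.
apply: (le_trans (lerD h3 h1)).
by rewrite mulrDl [leLHS]addrC [leLHS]addrA.
Qed.

End root_close.

Section root_close.
Variables (R : realType) (K : set (R * R)) (d : nat).
Variables (P_ : nat -> {poly {poly R[i]}}) (P : {poly {poly R[i]}}).
Hypotheses (cK : compact K) (d0 : (0 < d)%N).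
Hypotheses (sP_ : forall n, size (P_ n) = d.+1) (sP : size P = d.+1).
Hypothesis PU : forall j, (j <= d)%N ->
    exists2 U : set (R * R), set_nbhs K U &
      {uniform U, (fun n (z : R * R) => ((P_ n)`_j).[toC z] : R[i]^o) @ \oo -->
                  (fun z : R * R => (P`_j).[toC z] : R[i]^o)}.

Let root (x : R[i]) := Normc.normc x `^ d%:R^-1.

(** The majorant involves w and w - w' only: w' is eliminated so that, after integration, everything
    is controlled by the fixed limit measure and the L^1 distance to it. *)
Lemma root_close (theta : R) : 0 < theta -> exists2 Q : R, 0 <= Q &
  \forall n \near \oo, forall z (w w' : R[i]), K z ->
    let D := theta * (1 + 2 * Normc.normc w) + Q * Normc.normc (w - w') in
    root (eval2 (P_ n) (toC z) w') <= root (eval2 P (toC z) w) + D /\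
    root (eval2 P (toC z) w) <= root (eval2 (P_ n) (toC z) w') + D.
Proof.
move=> t0; have [C C0 hC] := eval2_close cK d0 sP_ sP PU.
have td0 : 0 < theta ^+ d by rewrite exprn_gt0.
(* With these values C e and (d+1) eta are each at most theta^d / 2, so that neither W^d nor (D/e)^d
   has a coefficient above theta^d. *)
pose e := theta ^+ d / (2 * (C + 1)).
pose eta := theta ^+ d / (2 * d.+1%:R).
have e0 : 0 < e by rewrite divr_gt0//; lra.
have eta0 : 0 < eta by rewrite divr_gt0// mulr_gt0.
have Ce : C * e <= theta ^+ d / 2.
  rewrite /e mulrA ler_pdivrMr; last by lra.
  have -> : theta ^+ d / 2 * (2 * (C + 1)) = theta ^+ d * (C + 1) by field.
  by rewrite mulrC ler_wpM2l ?(ltW td0)//; lra.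
have Deta : d.+1%:R * eta = theta ^+ d / 2.
  have : d.+1%:R != 0 :> R by rewrite pnatr_eq0.
  by rewrite /eta; move: (d.+1%:R : R) => x x0; field.
(* The summand [theta] pays for |w'| <= |w| + D inside W, and [theta / e] for the term (D/e)^d. *)
exists (theta + theta / e) => [|].
  by apply: addr_ge0; [exact: ltW|rewrite divr_ge0// ltW].
have := hC e eta e0 eta0; apply: filterS => n hn z w w' Kz.
move: (hn z w w' Kz); set W := 1 + _ + _; set X := Normc.normc (_ - eval2 _ _ _).
have := normc_ge0 (w - w'); set D := Normc.normc (w - w') => D0.
have w0 := normc_ge0 w; have w'0 := normc_ge0 w'.
have W0 : 0 <= W by rewrite /W; lra.
move=> XW.
have {}XW : X <= (theta * W) ^+ d + (theta / e * D) ^+ d.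
  apply: (le_trans XW); have -> : theta / e * D = theta * (D / e) by ring.
  rewrite !(exprMn _ theta); apply: lerD.
    by rewrite ler_wpM2r ?exprn_ge0// Deta; lra.
  by rewrite ler_wpM2r ?exprn_ge0 ?divr_ge0 ?(ltW e0)//; lra.
have ww' : W <= 1 + 2 * Normc.normc w + D.
  have : Normc.normc w' <= Normc.normc w + D.
    rewrite -{1}[w'](subKr w) (le_trans (le_normcD _ _))//.
    by rewrite normcN.
  by rewrite /W; lra.
have ab : theta * W + theta / e * D <=
    theta * (1 + 2 * Normc.normc w) + (theta + theta / e) * D.
  have : theta * W <= theta * (1 + 2 * Normc.normc w + D) by rewrite ler_wpM2l// ltW.
  by lra.
have a0 : 0 <= theta * W by rewrite mulr_ge0// ltW.
have b0 : 0 <= theta / e * D by rewrite mulr_ge0// divr_ge0// ltW.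
split.
- apply: le_trans (_ : _ <= root (eval2 P (toC z) w) + (theta * W + theta / e * D)) _.
    apply: (root_le_add d0); rewrite ?normc_ge0//.
    have : Normc.normc (eval2 (P_ n) (toC z) w') <= Normc.normc (eval2 P (toC z) w) + X.
      rewrite -{1}[eval2 (P_ n) _ _](subKr (eval2 P (toC z) w)) (le_trans (le_normcD _ _))//.
      by rewrite normcN.
    by move=> /le_trans; apply; rewrite lerD2l.
  by rewrite lerD2l.
- apply: le_trans (_ : _ <= root (eval2 (P_ n) (toC z) w') + (theta * W + theta / e * D)) _.
    apply: (root_le_add d0); rewrite ?normc_ge0//.
    have : Normc.normc (eval2 P (toC z) w) <= Normc.normc (eval2 (P_ n) (toC z) w') + X.
      rewrite -{1}[eval2 P _ _](subrK (eval2 (P_ n) (toC z) w')) (le_trans (le_normcD _ _))//.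
      by rewrite addrC.
    by move=> /le_trans; apply; rewrite lerD2l.
  by rewrite lerD2l.
Qed.

End root_close.

(** * Measurability and comparison of defects *)

Lemma cmeasurable_horner (R : realType) (p : {poly R[i]}) (h : plane R -> R[i]) :
  cmeasurable h -> cmeasurable (fun z => p.[h z]).
Proof.
move=> mh; under eq_fun do rewrite horner_coef.
apply: cmeasurable_sum => i; apply: cmeasurableM; first exact: cmeasurable_cst.
exact: cmeasurableX.
Qed.

Lemma cmeasurable_cauchy (R : realType) (mu : finite_measureC R) :
  cmeasurable (fun z : plane R => cauchy_transform mu (toC z)).
Proof. by split; [exact: measurable_cauchy_Re|exact: measurable_cauchy_Im]. Qed.

Lemma measurable_normc (R : realType) (h : plane R -> R[i]) :
  cmeasurable h -> measurable_fun setT (fun z => Normc.normc (h z)).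
Proof.
move=> [m1 m2].
have -> : (fun z => Normc.normc (h z)) =
    (fun z => Num.sqrt (complex.Re (h z) ^+ 2 + complex.Im (h z) ^+ 2)).
  by apply/funext => z; case: (h z).
apply: measurableT_comp; first by apply: continuous_measurable_fun; exact: sqrt_continuous.
by apply: measurable_funD; exact: measurable_funX.
Qed.

Section defect.
Variables (R : realType) (K : set (R * R)) (d : nat).
Hypotheses (cK : compact K) (d0 : (0 < d)%N).

Lemma measurable_defect (P : {poly {poly R[i]}}) (mu : finite_measureC R) :
  size P = d.+1 ->
  measurable_fun setT ((fun z => Normc.normc (eval2 P (toC z)
    (cauchy_transform mu (toC z))) `^ d%:R^-1) : plane R -> R).
Proof.
move=> sP; apply: (measurableT_comp (measurable_powR _)).
apply: measurable_normc; under eq_fun do rewrite (eval2E _ _ sP).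
apply: cmeasurable_sum => j; apply: cmeasurableM.
  by apply: cmeasurable_horner; exact: cmeasurable_toC.
by apply: cmeasurableX; exact: cmeasurable_cauchy.
Qed.

Lemma defectE (P : {poly {poly R[i]}}) (mu : finite_measureC R) : size P = d.+1 ->
  defect P K mu = (\int[area R]_(z in K) (Normc.normc (eval2 P (toC z)
    (cauchy_transform mu (toC z))) `^ d%:R^-1)%:E)%E.
Proof. by move=> sP; rewrite /defect /degw sP. Qed.

Lemma defect_le_add (P P' : {poly {poly R[i]}}) (mu mu' : finite_measureC R)
    (g : plane R -> R) : size P = d.+1 -> size P' = d.+1 -> measurable_fun setT g ->
  (forall z, 0 <= g z) ->
  (forall z, K z -> Normc.normc (eval2 P (toC z) (cauchy_transform mu (toC z))) `^ d%:R^-1 <=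
     Normc.normc (eval2 P' (toC z) (cauchy_transform mu' (toC z))) `^ d%:R^-1 + g z) ->
  (defect P K mu <= defect P' K mu' + \int[area R]_(z in K) (g z)%:E)%E.
Proof.
move=> sP sP' mg g0 h; have mK := plane_compact_measurable cK.
have mP := measurable_funTS (D := K) (measurable_defect mu sP).
have mP' := measurable_funTS (D := K) (measurable_defect mu' sP').
have mgK := measurable_funTS (D := K) mg.
rewrite !defectE// -ge0_integralD//; last 4 first.
- by move=> z _; rewrite lee_fin powR_ge0.
- exact/measurable_EFinP.
- by move=> z _; rewrite lee_fin.
- exact/measurable_EFinP.
apply: ge0_le_integral => //.
- by move=> z _; rewrite lee_fin powR_ge0.
- exact/measurable_EFinP.
- by apply: emeasurable_funD; apply/measurable_EFinP.
Qed.

Variables (P_ : nat -> {poly {poly R[i]}}) (P : {poly {poly R[i]}}).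
Hypotheses (sP_ : forall n, size (P_ n) = d.+1) (sP : size P = d.+1).
Hypothesis PU : forall j, (j <= d)%N ->
    exists2 U : set (R * R), set_nbhs K U &
      {uniform U, (fun n (z : R * R) => ((P_ n)`_j).[toC z] : R[i]^o) @ \oo -->
                  (fun z : R * R => (P`_j).[toC z] : R[i]^o)}.

(** The sequence of measures is already extracted while the polynomials are reindexed by [phi],
    which serves both a subsequence and, with [phi] the identity, a recovery sequence. Two
    inequalities replace a difference, as the defects lie in the extended reals. *)
Lemma defect_close (phi : nat -> nat) (mu_ : nat -> finite_measureC R)
    (mu : finite_measureC R) (M : R) :
  (forall n, (n <= phi n)%N) ->
  (forall n, mu_ n (~` K) = 0%E) -> mu (~` K) = 0%E ->
  (forall n, (mu_ n setT <= M%:E)%E) -> (mu setT <= M%:E)%E ->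
  plane_weak_cvg K mu_ mu ->
  forall e : R, 0 < e -> \forall n \near \oo,
    (defect (P_ (phi n)) K (mu_ n) <= defect P K mu + e%:E)%E /\
    (defect P K mu <= defect (P_ (phi n)) K (mu_ n) + e%:E)%E.
Proof.
move=> phin muK_ muK muM_ muM wcvg e e0; have mK := plane_compact_measurable cK.
pose C nu (z : plane R) := cauchy_transform nu (toC z).
pose a (z : plane R) := `|complex.Re (C mu z)| + `|complex.Im (C mu z)|.
pose b n (z : plane R) := `|complex.Re (C (mu_ n) z) - complex.Re (C mu z)| +
  `|complex.Im (C (mu_ n) z) - complex.Im (C mu z)|.
have ma : measurable_fun setT a.
  by apply: measurable_funD; apply: measurableT_comp => //;
    [exact: measurable_cauchy_Re|exact: measurable_cauchy_Im].
have mb n : measurable_fun setT (b n).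
  apply: measurable_funD; apply: measurableT_comp => //; apply: measurable_funB.
  - exact: measurable_cauchy_Re.
  - exact: measurable_cauchy_Re.
  - exact: measurable_cauchy_Im.
  - exact: measurable_cauchy_Im.
have a0 z : 0 <= a z by rewrite addr_ge0.
have b0 n z : 0 <= b n z by rewrite addr_ge0.
(* This integral is finite and depends on the limit measure only, so [theta] can be fixed before
   n. *)
pose A := fine (\int[area R]_(z in K) (1 + 2 * a z)%:E)%E.
have AE : (\int[area R]_(z in K) (1 + 2 * a z)%:E = A%:E)%E.
  rewrite fineK// ge0_fin_numE; last first.
    by apply: integral_ge0 => z _; rewrite lee_fin addr_ge0// mulr_ge0.
  under eq_integral do rewrite EFinD EFinM.
  rewrite ge0_integralD//; last 2 first.
  - by move=> z _; rewrite -EFinM lee_fin mulr_ge0.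
  - by apply/measurable_EFinP; apply: measurable_funM => //; exact: measurable_funTS.
  rewrite integral_cst// mul1e ge0_integralZl//; last 2 first.
  - by apply/measurable_EFinP; exact: measurable_funTS.
  - by move=> z _; rewrite lee_fin.
  rewrite lte_add_pinfty//; first exact: compact_area_lty.
  by rewrite lte_mul_pinfty//; exact: cauchy_integral_lty.
have A0 : 0 <= A.
  by apply: fine_ge0; apply: integral_ge0 => z _; rewrite lee_fin addr_ge0// mulr_ge0.
(* Half of e goes to theta A. The constant Q is known only once [theta] is; the L^1 distance is then
   required to be at most e / (2 (Q + 1)), which costs at most the other half. *)
pose theta := e / (2 * (A + 1)).
have theta0 : 0 < theta by rewrite divr_gt0//; lra.
have [Q Q0 hQ] := root_close cK d0 sP_ sP PU theta0.
have eQ : 0 < e / (2 * (Q + 1)) by rewrite divr_gt0//; lra.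
have L1 := cauchy_cvg_L1 cK muK_ muK muM_ muM wcvg eQ.
have hphi : \forall n \near \oo, forall z (w w' : R[i]), K z ->
    let D := theta * (1 + 2 * Normc.normc w) + Q * Normc.normc (w - w') in
    Normc.normc (eval2 (P_ (phi n)) (toC z) w') `^ d%:R^-1 <=
      Normc.normc (eval2 P (toC z) w) `^ d%:R^-1 + D /\
    Normc.normc (eval2 P (toC z) w) `^ d%:R^-1 <=
      Normc.normc (eval2 (P_ (phi n)) (toC z) w') `^ d%:R^-1 + D.
  case: hQ => N _ hN; exists N => // n /= Nn.
  by apply: hN => /=; exact: leq_trans (phin n).
apply: filterS2 L1 hphi => n L1n hn.
pose g z := theta * (1 + 2 * a z) + Q * b n z.
have g0 z : 0 <= g z.
  apply: addr_ge0; apply: mulr_ge0 => //; first exact: ltW.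
  by apply: addr_ge0 => //; exact: mulr_ge0.
have mg : measurable_fun setT g.
  apply: measurable_funD; apply: measurable_funM => //.
  by apply: measurable_funD => //; exact: measurable_funM.
have Dg z : theta * (1 + 2 * Normc.normc (C mu z)) + Q * Normc.normc (C mu z - C (mu_ n) z) <= g z.
  apply: lerD.
    by rewrite ler_wpM2l ?(ltW theta0)// lerD2l ler_wpM2l//; exact: normc_le_abs.
  rewrite ler_wpM2l// (le_trans (normc_le_abs _))// !raddfB/= /b.
  by rewrite distrC lerD2l distrC.
have gint : (\int[area R]_(z in K) (g z)%:E <= e%:E)%E.
  rewrite /g; under eq_integral do rewrite EFinD (EFinM theta) (EFinM Q).
  have maK := measurable_funTS (D := K) ma; have mbK := measurable_funTS (D := K) (mb n).
  rewrite ge0_integralD//; last 4 first.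
  - move=> z _; rewrite -EFinM lee_fin; apply: mulr_ge0; first exact: ltW.
    by apply: addr_ge0 => //; exact: mulr_ge0.
  - apply/measurable_EFinP; apply: measurable_funM => //.
    by apply: measurable_funD => //; exact: measurable_funM.
  - by move=> z _; rewrite -EFinM lee_fin mulr_ge0.
  - by apply/measurable_EFinP; exact: measurable_funM.
  have -> : (\int[area R]_(z in K) (theta%:E * (1 + 2 * a z)%:E) = theta%:E * A%:E)%E.
    rewrite -AE; apply: ge0_integralZl => //.
    - apply/measurable_EFinP; apply: measurable_funD => //; exact: measurable_funM.
    - by move=> z _; rewrite lee_fin addr_ge0// mulr_ge0.
    - by rewrite lee_fin ltW.
  have -> : (\int[area R]_(z in K) (Q%:E * (b n z)%:E) =
      Q%:E * \int[area R]_(z in K) (b n z)%:E)%E.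
    apply: ge0_integralZl => //; first exact/measurable_EFinP.
    by move=> z _; rewrite lee_fin.
  apply: (@le_trans _ _ (theta%:E * A%:E + Q%:E * (e / (2 * (Q + 1)))%:E)%E).
    by rewrite leeD2l// lee_wpmul2l// lee_fin.
  rewrite -!EFinM -EFinD lee_fin.
  have h1 : theta * A <= e / 2.
    rewrite /theta mulrAC ler_pdivrMr; last by lra.
    have -> : e / 2 * (2 * (A + 1)) = e * (A + 1) by field.
    by rewrite ler_wpM2l ?(ltW e0)//; lra.
  have h2 : Q * (e / (2 * (Q + 1))) <= e / 2.
    rewrite mulrA ler_pdivrMr; last by lra.
    have -> : e / 2 * (2 * (Q + 1)) = e * (Q + 1) by field.
    by rewrite mulrC ler_wpM2l ?(ltW e0)//; lra.
  by lra.
split.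
- apply: le_trans (_ : _ <= defect P K mu + \int[area R]_(z in K) (g z)%:E)%E _;
    last by rewrite leeD2l.
  apply: defect_le_add => // z Kz.
  by have [h _] := hn z (C mu z) (C (mu_ n) z) Kz; rewrite (le_trans h)// lerD2l.
- apply: le_trans (_ : _ <= defect (P_ (phi n)) K (mu_ n) + \int[area R]_(z in K) (g z)%:E)%E _;
    last by rewrite leeD2l.
  apply: defect_le_add => // z Kz.
  by have [_ h] := hn z (C mu z) (C (mu_ n) z) Kz; rewrite (le_trans h)// lerD2l.
Qed.

End defect.

(** * Moments and representing measures under weak limits *)

Section moments.
Variables (R : realType) (K : set (R * R)).
Hypothesis cK : compact K.

Lemma toCX_continuous k :
  continuous (fun z : R * R => complex.Re (toC z ^+ k)) /\
  continuous (fun z : R * R => complex.Im (toC z ^+ k)).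
Proof.
elim: k => [|k [IHr IHi]]; first by split => z; exact: cvg_cst.
split.
- have -> : (fun z : R * R => complex.Re (toC z ^+ k.+1)) = (fun z =>
      z.1 * complex.Re (toC z ^+ k) - z.2 * complex.Im (toC z ^+ k)).
    by apply/funext => z; rewrite exprS ReM.
  by move=> z; apply: cvgB; apply: cvgM; [exact: cvg_fst|exact: IHr|exact: cvg_snd|exact: IHi].
- have -> : (fun z : R * R => complex.Im (toC z ^+ k.+1)) = (fun z =>
      z.1 * complex.Im (toC z ^+ k) + z.2 * complex.Re (toC z ^+ k)).
    by apply/funext => z; rewrite exprS ImM.
  by move=> z; apply: cvgD; apply: cvgM; [exact: cvg_fst|exact: IHi|exact: cvg_snd|exact: IHr].
Qed.

Lemma moment_cvg (mu_ : nat -> finite_measureC R) (mu : finite_measureC R) k :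
  (forall n, mu_ n (~` K) = 0%E) -> mu (~` K) = 0%E -> plane_weak_cvg K mu_ mu ->
  complex.Re (moment (mu_ n) k) @[n --> \oo] --> complex.Re (moment mu k) /\
  complex.Im (moment (mu_ n) k) @[n --> \oo] --> complex.Im (moment mu k).
Proof.
move=> muK_ muK wcvg; have mk : cmeasurable (fun z : plane R => toC z ^+ k).
  by apply: cmeasurableX; exact: cmeasurable_toC.
have [cr ci] := toCX_continuous k.
have E (nu : finite_measureC R) : nu (~` K) = 0%E ->
    moment nu k = Complex (\int[nu]_(z in K) complex.Re (toC z ^+ k))
      (\int[nu]_(z in K) complex.Im (toC z ^+ k)).
  by move=> nuK; exact: (integralC_support cK nuK mk).
have -> : (fun n => complex.Re (moment (mu_ n) k)) =
    (fun n => \int[mu_ n]_(z in K) complex.Re (toC z ^+ k)).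
  by apply/funext => n; rewrite E.
have -> : (fun n => complex.Im (moment (mu_ n) k)) =
    (fun n => \int[mu_ n]_(z in K) complex.Im (toC z ^+ k)).
  by apply/funext => n; rewrite E.
by rewrite E//=; split; exact: wcvg.
Qed.

Lemma moment0 (mu : finite_measureC R) : (mu setT = (complex.Re (moment mu 0))%:E)%E.
Proof.
rewrite -[RHS]/((\int[mu]_(z in setT) 1)%:E).
by rewrite Rintegral_cst// mul1r fineK// fin_num_measure.
Qed.

Lemma representing_mass (f : germ R) (mu : finite_measureC R) :
  representing f K mu -> (mu setT = (complex.Re (germ_coef f 0))%:E)%E.
Proof. by move=> fmu; rewrite moment0 (representing_moments cK fmu). Qed.

Lemma representing_weak_limit (f_ : nat -> germ R) (f : germ R)
    (mu_ : nat -> finite_measureC R) (mu : finite_measureC R) (phi : nat -> nat) :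
  (forall n, (n <= phi n)%N) -> (forall n, representing (f_ (phi n)) K (mu_ n)) ->
  mu (~` K) = 0%E -> plane_weak_cvg K mu_ mu ->
  (forall k, (germ_coef (f_ n) k : R[i]^o) @[n --> \oo] --> (germ_coef f k : R[i]^o)) ->
  representing f K mu.
Proof.
move=> phin fmu muK wcvg cf; apply: moments_representing => // k.
have [c1 c2] := moment_cvg k (fun n => (fmu n).1) muK wcvg.
have phioo : phi @ \oo --> \oo.
  by move=> A [N _ NA]; exists N => // n /= Nn; apply: NA; exact: (leq_trans Nn (phin n)).
have E n : moment (mu_ n) k = germ_coef (f_ (phi n)) k by exact: (representing_moments cK (fmu n)).
have d1 : complex.Re (moment (mu_ n) k) @[n --> \oo] --> complex.Re (germ_coef f k).
  have -> : (fun n => complex.Re (moment (mu_ n) k)) =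
      (fun n => complex.Re (germ_coef (f_ n) k)) \o phi by apply/funext => n; rewrite E.
  exact: (cvg_comp _ _ phioo (cvg_Re (cf k))).
have d2 : complex.Im (moment (mu_ n) k) @[n --> \oo] --> complex.Im (germ_coef f k).
  have -> : (fun n => complex.Im (moment (mu_ n) k)) =
      (fun n => complex.Im (germ_coef (f_ n) k)) \o phi by apply/funext => n; rewrite E.
  exact: (cvg_comp _ _ phioo (cvg_Im (cf k))).
have e1 := cvg_unique (@Rhausdorff R) c1 d1.
have e2 := cvg_unique (@Rhausdorff R) c2 d2.
by case: (moment mu k) (germ_coef f k) e1 e2 => x y [x' y'] /= -> ->.
Qed.

End moments.

(** * Lower and upper limits of the minimal defects *)

Lemma limn_einf_lt_frequently (R : realType) (u : (\bar R)^nat) (c : \bar R) :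
  (limn_einf u < c)%E -> forall N, exists2 n, (N <= n)%N & (u n < c)%E.
Proof.
move=> uc N; have : (einfs u N < c)%E.
  apply: le_lt_trans uc; rewrite limn_einf_lim.
  have nd := nondecreasing_einfs u.
  by rewrite (cvg_lim _ (ereal_nondecreasing_cvgn nd))//; apply: ereal_sup_ubound; exists N.
by move=> /ereal_inf_lt[_ [n /= Nn <-] unc]; exists n.
Qed.

(** The sequence is squeezed between its tail infima and tail suprema, both of which tend to l. *)
Lemma limn_esup_le_einf_cvg (R : realType) (u : (\bar R)^nat) (l : \bar R) :
  (l <= limn_einf u)%E -> (limn_esup u <= l)%E -> u @ \oo --> l.
Proof.
move=> l_le le_l; have le := limn_einf_sup u.
have E1 : limn_einf u = l by apply/eqP; rewrite eq_le l_le (le_trans le).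
have E2 : limn_esup u = l by apply/eqP; rewrite eq_le le_l (le_trans l_le).
apply: (@squeeze_cvge _ _ _ _ (einfs u) _ (esups u)).
- apply: nearW => n; apply/andP; split.
    by apply: ereal_inf_lbound; exists n => /=.
  by apply: ereal_sup_ubound; exists n => /=.
- by rewrite -E1 limn_einf_lim; exact: is_cvg_einfs.
- by rewrite -E2 limn_esup_lim; exact: is_cvg_esups.
Qed.

Theorem theorem10p1 (R : realType) (K : set (R * R))
  (d : nat) (P_ : nat -> {poly {poly R[i]}}) (P : {poly {poly R[i]}})
  (f_ : nat -> germ R) (f : germ R) :
  compact K -> convex_set (K : set (convex_lmodType (R * R)%type)) ->
  (0 < d)%N ->
  (forall n, size (P_ n) = d.+1) -> size P = d.+1 ->
  (forall j, (j <= d)%N ->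
    exists2 U : set (R * R), set_nbhs K U &
      {uniform U, (fun n (z : R * R) => ((P_ n)`_j).[toC z] : R[i]^o) @ \oo -->
                  (fun z : R * R => (P`_j).[toC z] : R[i]^o)}) ->
  (forall n, positive_algebraic (f_ n)) -> positive_algebraic f ->
  (forall n, annihilates (P_ n) (f_ n)) -> annihilates P f ->
  (forall n, representing (f_ n) K !=set0) -> representing f K !=set0 ->
  (forall k, (germ_coef (f_ n) k : R[i]^o) @[n --> \oo] -->
             (germ_coef f k : R[i]^o)) ->
  (delta P f K <= limn_einf (fun n => delta (P_ n) (f_ n) K))%E /\
  (forall (mu : finite_measureC R) (mu_ : nat -> finite_measureC R),
    minimizer P f K mu ->
    (forall n, representing (f_ n) K (mu_ n)) -> weak_star_cvg K mu_ mu ->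
    delta (P_ n) (f_ n) K @[n --> \oo] --> delta P f K).
Proof.
move=> cK _ d0 sP_ sP PU _ _ _ _ _ _ cf.
have [M coefM] : exists M, forall n, complex.Re (germ_coef (f_ n) 0) <= M.
  have [A [_ hA]] := cvg_seq_bounded (cvgP _ (cvg_Re (cf 0%N))).
  exists (A + 1) => n; apply: le_trans (ler_norm _) _.
  by apply: (hA (A + 1)) => //; rewrite ltrDl.
have massM n mu : representing (f_ n) K mu -> (mu setT <= M%:E)%E.
  by move=> fmu; rewrite (representing_mass cK fmu) lee_fin.
have liminf_ge : (delta P f K <= limn_einf (fun n => delta (P_ n) (f_ n) K))%E.
  (* Approaching the lower limit through real numbers c above it provides measures of defect below c
     without a minimizer, and leaves the infinite values of the lower limit to a separate case. *)
  have key (c : R) : (limn_einf (fun n => delta (P_ n) (f_ n) K) < c%:E)%E ->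
      (delta P f K <= c%:E)%E.
    move=> /limn_einf_lt_frequently freq.
    (* Index and measure are chosen together, with index at least N; the extraction below acts on N,
       so the polynomials end up reindexed by n |-> [(s (phi n)).1]. *)
    have /choice[s hs] N : exists s : nat * finite_measureC R,
        [/\ (N <= s.1)%N, representing (f_ s.1) K s.2 & (defect (P_ s.1) K s.2 < c%:E)%E].
      have [n Nn /ereal_inf_lt[_ [nu fnu <-] nuc]] := freq N.
      by exists (n, nu).
    have fs N : representing (f_ (s N).1) K (s N).2 by have [] := hs N.
    have [phi [mu [phin muK muM wcvg]]] := weak_compactness cK
      (fun N => (fs N).1) (fun N => massM _ _ (fs N)).
    have sphin n : (n <= (s (phi n)).1)%N.
      by apply: leq_trans (phin n) _; have [] := hs (phi n).
    have fmu : representing f K mu.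
      exact: (representing_weak_limit cK sphin (fun n => fs (phi n)) muK wcvg cf).
    apply: (@le_trans _ _ (defect P K mu)); first by apply: ereal_inf_lbound; exists mu.
    apply/lee_addgt0Pr => e e0.
    have [N _ hN] := defect_close cK d0 sP_ sP PU sphin (fun n => (fs (phi n)).1) muK
      (fun n => massM _ _ (fs (phi n))) muM wcvg e0.
    have [_ h] := hN N (leqnn N); apply: (le_trans h).
    by rewrite leeD2r// ltW//; have [] := hs (phi N).
  case: (limn_einf _) key => [l| |] key; last 2 first.
  - exact: leey.
  (* A lower limit equal to -oo would force the minimal defect for P below -1, whereas defects are
     nonnegative. *)
  - have /key := ltNyr (-1 : R); rewrite leNgt => /negP; case.
    apply: (@lt_le_trans _ _ 0%E); first by rewrite lte_fin ltrN10.
    apply: le_ereal_inf_tmp => _ [nu _ <-].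
    by apply: integral_ge0 => z _; rewrite lee_fin powR_ge0.
  apply/lee_addgt0Pr => e e0; rewrite -EFinD; apply: key.
  by rewrite lte_fin ltrDl.
split => // mu mu_ [fmu deltaE] fmu_ wstar.
have wcvg : plane_weak_cvg K mu_ mu.
  by move=> g cg; apply: wstar; exact: continuous_subspaceT.
pose M' := Num.max M (complex.Re (germ_coef f 0)).
have muM_ n : (mu_ n setT <= M'%:E)%E.
  by rewrite (le_trans (massM _ _ (fmu_ n)))// lee_fin le_max lexx.
have muM : (mu setT <= M'%:E)%E.
  by rewrite (representing_mass cK fmu) lee_fin le_max lexx orbT.
have limsup_le : (limn_esup (fun n => delta (P_ n) (f_ n) K) <= delta P f K)%E.
  apply/lee_addgt0Pr => e e0.
  have [N _ hN] := defect_close cK d0 sP_ sP PU (phi := id) (fun n => leqnn n)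
    (fun n => (fmu_ n).1) fmu.1 muM_ muM wcvg e0.
  rewrite limn_esup_lim; apply: lime_le; first exact: is_cvg_esups.
  exists N => // n /= Nn; apply: ge_ereal_sup => _ [m /= nm <-].
  have [h _] := hN m (leq_trans Nn nm); rewrite deltaE in h.
  by apply: le_trans h; apply: ereal_inf_lbound; exists (mu_ m).
exact: limn_esup_le_einf_cvg.
Qed.
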